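(* Let $\mathcal F:\mathcal P_2(\mathbb R^d)\to(-\infty,\infty]$ be proper, lower semicontinuous and geodesically convex, with minimizer $\pi$. Let $(\mu_t)_{t\ge0}$ be the forward Euler iterates with adaptive step sizes $\eta_t=\bar r_t/\sqrt{G_t}$, $t\ge0$, where $\bar r_t=\max\{r_\varepsilon,\max_{0\le s\le t}W_2(\mu_0,\mu_s)\}$, $G_t=\sum_{s=0}^t\int_{\mathbb R^d}\|\xi_s(x)\|^2\,\mathrm d\mu_s(x)$, $\xi_s=\nabla_{W_2}\mathcal F(\mu_s)$, and $r_\varepsilon>0$. Let $(\bar\mu_t)_{t\ge1}$ be the uniform averages $\bar\mu_1=\mu_0$, $\bar\mu_{t+1}=\big[(1-\tfrac1{t+1})\,\mathrm{id}+\tfrac1{t+1}\,\boldsymbol t_{\bar\mu_t}^{\mu_t}\big]_\#\bar\mu_t$ for $t\ge1$. Let $T\ge1$, $D\ge d_0:=W_2(\mu_0,\pi)$ and $G=\sup_{0\le t\le T}\|\xi_t\|_{L^2(\mu_t)}$. Then there is a universal constant $C>0$ such that, on the event $\{\bar r_T\le D\}$, $$\mathcal F(\bar\mu_T)-\mathcal F(\pi)\le C\,\frac{DG}{\sqrt T}\log_+\Big(\frac D{r_\varepsilon}\Big).$$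
   Context: $\log_+(x):=1+\log x$. $\mathcal P_2(\mathbb R^d)$: Borel probability measures on $\mathbb R^d$ with finite second moment; $W_2$: quadratic Wasserstein distance; $T_\#\mu$: pushforward; $\boldsymbol t_\mu^\nu$: optimal transport map from $\mu$ to $\nu$ (whenever written, it is assumed to exist; the paper restricts the domain $\{\mathcal F<\infty\}$ to absolutely continuous measures for this purpose). Proper: $\mathcal F(\mu)<\infty$ for some $\mu$. Geodesically convex: for all $\mu,\nu$ there is a constant speed $W_2$-geodesic $(\lambda_s)_{s\in[0,1]}$ from $\mu$ to $\nu$ with $\mathcal F(\lambda_s)\le(1-s)\mathcal F(\mu)+s\mathcal F(\nu)$ for all $s\in[0,1]$. Wasserstein gradient: $\xi\in L^2(\mu)$ belongs to the Fréchet subdifferential $\partial\mathcal F(\mu)$ if $\mathcal F(\nu)-\mathcal F(\mu)\ge\int\langle\xi(x),\boldsymbol t_\mu^\nu(x)-x\rangle\,\mathrm d\mu(x)+o(W_2(\mu,\nu))$ for all $\nu$ with $\mathcal F(\nu)<\infty$; for geodesically convex $\mathcal F$ this is equivalent to the same inequality without the $o(\cdot)$ term. $\nabla_{W_2}\mathcal F(\mu)$ is the element of $\partial\mathcal F(\mu)$ of minimal $L^2(\mu)$ norm (assumed to exist along the iterates). In the paper, $\mathcal F(\mu)=\int V\,\mathrm d\mu+\frac12\iint W(x-y)\,\mathrm d\mu(x)\mathrm d\mu(y)+\int H(\mu(x))\,\mathrm dx$ is a sum of potential, interaction and internal energies. Forward Euler iterates: given $\mu_0\in\mathcal P_2(\mathbb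 R^d)$ and step sizes $\eta_t>0$, $\mu_{t+1}=(\mathrm{id}-\eta_t\xi_t)_\#\mu_t$ with $\xi_t=\nabla_{W_2}\mathcal F(\mu_t)$, $t\ge0$. Denominators in the step size formula are understood to be positive. (Everything is deterministic; ''on the event'' means whenever the stated inequality holds.) *)

(* Defs.v *)
From HB Require Import structures.
From mathcomp Require Import all_boot all_order all_algebra.
From mathcomp Require Import all_classical all_reals all_analysis.

Set Implicit Arguments.
Unset Strict Implicit.
Unset Printing Implicit Defensive.
Import Order.TTheory GRing.Theory Num.Theory.
Import numFieldNormedType.Exports.
Local Open Scope classical_set_scope.
Local Open Scope ring_scope.

(* R^d is 'rV[R]_d with its Borel sigma-algebra. *)
HB.instance Definition _ (R : realType) (m n : nat) :=
  @isMeasurable.Build (sigma_display (@open 'M[R]_(m, n))) 'M[R]_(m, n)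
    <<s @open 'M[R]_(m, n) >>
    (@sigma_algebra0 _ setT (@open 'M[R]_(m, n)))
    (@sigma_algebraC _ (@open 'M[R]_(m, n)))
    (@sigma_algebra_bigcup _ setT (@open 'M[R]_(m, n))).

Section EuclideanSpace.
Context {R : realType}.

Definition dotv {d : nat} (x y : 'rV[R]_d) : R :=
  \sum_(i < d) x ord0 i * y ord0 i.

(* The library norm `|x| on 'rV[R]_d is the sup norm, hence this one. *)
Definition sqnorm {d : nat} (x : 'rV[R]_d) : R := dotv x x.

(* Lebesgue measure on R^d, as an iterated product along R^(1+d) = R x R^d. *)
Fixpoint lebesgue_rV (d : nat) : set 'rV[R]_d -> \bar R :=
  match d with
  | 0%N => \d_(0 : 'rV[R]_0)
  | d'.+1 =>
      pushforward
        ((@lebesgue_measure R) \x (@lebesgue_rV d'))%E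
        (fun p : measurableTypeR R * 'rV[R]_d' =>
           row_mx (p.1)%:M p.2 : 'rV[R]_(1 + d'))
  end.

End EuclideanSpace.
Arguments lebesgue_rV {R} d A.

(* Measures are functions on all subsets, so equality of measures is tested on
   measurable sets only. *)
Definition eq_meas d (T : measurableType d) (R : realType)
    (m1 m2 : set T -> \bar R) : Prop :=
  forall A, measurable A -> m1 A = m2 A.

Record P2 (R : realType) (d : nat) := MkP2 {
  P2_prob :> probability 'rV[R]_d R ;
  P2_moment : (\int[P2_prob]_x (sqnorm x)%:E < +oo)%E }.

Section Wasserstein.
Context {R : realType} {d : nat}.
Local Notation V := 'rV[R]_d.
Implicit Types (mu nu : P2 R d) (t : V -> V).

Definition coupling mu nu (g : probability (V * V)%type R) : Prop :=
  eq_meas (pushforward g fst) mu /\ eq_meas (pushforward g snd) nu.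

Definition W2 mu nu : R :=
  Num.sqrt (fine (ereal_inf
    [set (\int[g]_p (sqnorm (p.1 - p.2))%:E)%E | g in coupling mu nu])).

(* nu = t_# mu *)
Definition is_pushforward t mu nu : Prop :=
  measurable_fun setT t /\ eq_meas nu (pushforward mu t).

(* t is an optimal transport map from mu to nu *)
Definition is_ot_map mu nu t : Prop :=
  is_pushforward t mu nu /\
  (\int[mu]_x (sqnorm (x - t x))%:E)%E = (W2 mu nu ^+ 2)%:E.

(* Constant speed geodesic on [0, 1]; lam is irrelevant outside. *)
Definition geodesic mu nu (lam : R -> P2 R d) : Prop :=
  [/\ eq_meas (lam 0) mu, eq_meas (lam 1) nu &
      forall r s, 0 <= r <= 1 -> 0 <= s <= 1 ->
        W2 (lam r) (lam s) = `|r - s| * W2 mu nu].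

End Wasserstein.

Section Functionals.
Context {R : realType} {d : nat}.
Local Notation V := 'rV[R]_d.
Variable F : P2 R d -> \bar R.
Implicit Types (mu nu : P2 R d) (xi : V -> V).
Local Open Scope ereal_scope.

Definition is_proper : Prop := exists mu, F mu < +oo.

(* Lower semicontinuity for W2; it also forces F to agree on measures that
   coincide on all Borel sets, as these are at W2-distance 0. *)
Definition W2_lsc : Prop := forall mu (a : R), a%:E < F mu ->
  exists2 delta : R, (0 < delta)%R &
    forall nu, (W2 mu nu < delta)%R -> a%:E < F nu.

Definition geodesically_convex : Prop := forall mu nu,
  exists2 lam : R -> P2 R d, geodesic mu nu lam &
    forall s : R, (0 <= s <= 1)%R ->
      F (lam s) <= (1 - s)%:E * F mu + s%:E * F nu.

Definition L2sqnorm mu xi : R := fine (\int[mu]_x (sqnorm (xi x))%:E).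

Definition L2norm mu xi : R := Num.sqrt (L2sqnorm mu xi).

Definition in_L2 mu xi : Prop :=
  measurable_fun setT xi /\ \int[mu]_x (sqnorm (xi x))%:E < +oo.

(* The o(W2(mu, nu)) error is spelled out with eps and delta. *)
Definition subdiff mu xi : Prop :=
  [/\ F mu < +oo, in_L2 mu xi &
      forall eps : R, (0 < eps)%R -> exists2 delta : R, (0 < delta)%R &
        forall nu t, F nu < +oo -> is_ot_map mu nu t -> (W2 mu nu < delta)%R ->
          \int[mu]_x (dotv (xi x) (t x - x))%:E - (eps * W2 mu nu)%:E
            <= F nu - F mu].

(* xi represents the Wasserstein gradient: the minimal norm subgradient. *)
Definition is_wgrad mu xi : Prop :=
  subdiff mu xi /\
  forall zeta, subdiff mu zeta -> (L2norm mu xi <= L2norm mu zeta)%R.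

End Functionals.

Section AdaptiveSteps.
Context {R : realType} {d : nat}.
Variables (reps : R) (mu : nat -> P2 R d) (xi : nat -> 'rV[R]_d -> 'rV[R]_d).

Definition rbar (t : nat) : R :=
  \big[Num.max/reps]_(s < t.+1) W2 (mu 0%N) (mu s).

Definition Gsum (t : nat) : R := \sum_(s < t.+1) L2sqnorm (mu s) (xi s).

Definition stepsize (t : nat) : R := rbar t / Num.sqrt (Gsum t).

Definition Gsup (T : nat) : R :=
  sup [set L2norm (mu t) (xi t) | t in [set t | (t <= T)%N]].

End AdaptiveSteps.

Definition log_plus (R : realType) (x : R) : R := 1 + ln x.

(* Main.v *)
Require Import Defs.
From HB Require Import structures.
From mathcomp Require Import all_boot all_order all_algebra.
From mathcomp Require Import all_classical all_reals all_analysis.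
From mathcomp Require Import measurable_realfun ring lra.
Import Order.TTheory GRing.Theory Num.Theory.
Import numFieldNormedType.Exports.
Local Open Scope classical_set_scope.
Local Open Scope ring_scope.

(** Let f_t = F(mu_t) - F(pi) and d_t = W_2(mu_t, pi). Convexity of F along a
geodesic from mu_t to pi, tested against the Frechet subdifferential near mu_t,
gives the usual descent inequality
  2 eta_t f_t <= d_t^2 - d_(t+1)^2 + eta_t^2 |xi_t|^2.
Weighting it by rbar_t makes the coefficients sqrt(G_t) monotone, so the weighted
sums telescope to sum_(s <= t) rbar_s f_s = O(D rbar_t sqrt(G_t)); this uses
rbar_(t+1) <= 2 rbar_t. A second Abel summation removes the weights at the price
of sum_t (1 - rbar_t / rbar_(t+1)) <= ln (rbar_T / r_eps).

To bound F at the averages by the average of the F(mu_t), the prescribed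
interpolation has to be the geodesic along which F is convex, that is, optimal
maps out of an absolutely continuous measure must be unique. If v1, v2 are two
optimal maps, then <x - y, v1(x) - v2(y)> >= 0 for almost all pairs (x, y).
Hence the set where the k-th coordinate of v1 lies below that of v2 by a fixed
gap meets, up to a null set, every line in direction e_k in at most one point,
and it is Lebesgue-null by Tonelli. *)

(** * Borel structure of R^d *)

Section Borel.
Context {R : realType}.

(** These boxes form a base of the topology with a countable index type, so unions over it preserve
    measurability and nullity. *)
Definition ratball d (c : 'rV[rat]_d * nat) : set 'rV[R]_d :=
  [set x | forall i, `|x ord0 i - ratr (c.1 ord0 i)| < c.2.+1%:R^-1].

Lemma ratball_small d (x : 'rV[R]_d) (e : R) : 0 < e ->
  exists2 c, ratball d c x &
    forall y, ratball d c y -> forall i, `|x ord0 i - y ord0 i| < e.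
Proof.
move=> e0.
have e20 : 0 < e / 2 by rewrite divr_gt0.
have [n _ /(_ n (leqnn n)) /= hn] := near_infty_natSinv_lt (PosNum e20).
have n0 : 0 < n.+1%:R^-1 :> R by rewrite invr_gt0.
have q_ i : exists q : rat, `|x ord0 i - ratr q| < n.+1%:R^-1.
  have [|q] := @rat_in_itvoo R (x ord0 i - n.+1%:R^-1) (x ord0 i + n.+1%:R^-1).
    by rewrite ltrBlDr -addrA ltrDl addr_gt0.
  by rewrite in_itv/= => qi; exists q; rewrite distrC ltr_distl.
have [q qP] := choice q_.
exists (\row_i q i, n) => [i /=|y yc i]; first by rewrite mxE.
have /= := yc i; rewrite mxE => {}yc.
rewrite -(subrKA (ratr (q i))) (le_lt_trans (ler_normD _ _))//.
rewrite (splitr e) ltrD//; first exact: lt_trans (qP i) hn.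
by rewrite distrC (lt_trans yc).
Qed.

Lemma ratballE d c : ratball d c = \bigcap_(i in [set: 'I_d])
  ((fun x : 'rV[R]_d => x ord0 i) @^-1`
    ball (ratr (c.1 ord0 i) : R) (c.2.+1%:R^-1 : R)).
Proof.
apply/seteqP; split=> [x h i _|x h i].
  by rewrite /= -ball_normE /= distrC; exact: h.
by have := h i I; rewrite /= -ball_normE /= distrC.
Qed.

Lemma open_ratball d (O : set 'rV[R]_d) : open O ->
  O = \bigcup_(c in [set c | ratball d c `<=` O]) ratball d c.
Proof.
move=> oO; apply/seteqP; split=> [x Ox|x [c /= cO cx]]; last exact: cO.
have /nbhs_ballP[e /= e0 eO] : nbhs x O by move: oO; rewrite openE; apply.
have [c cx cP] := @ratball_small d x e e0.
exists c => //= y /cP cy; apply: eO; split=> // i j.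
by rewrite (ord1 i); exact: cy.
Qed.

Lemma bigcup_count_measurable (I : countType) dT (T : measurableType dT)
  (D : set I) (F : I -> set T) : (forall i, D i -> measurable (F i)) ->
  measurable (\bigcup_(i in D) F i).
Proof.
move=> mF; rewrite [X in measurable X](_ : _ =
    \bigcup_n (if unpickle n is Some i then if i \in D then F i else set0 else set0)).
  apply: bigcupT_measurable => n; case: unpickle => // i.
  by case: ifPn => // /set_mem; exact: mF.
apply/seteqP; split=> [x [i Di Fix]|x [n _]].
  by exists (pickle i) => //; rewrite pickleK mem_set.
by case: unpickle => // i; case: ifPn => // /set_mem Di Fi; exists i.
Qed.

Lemma measurable_open d (O : set 'rV[R]_d) : open O -> measurable O.
Proof. exact: sub_sigma_algebra. Qed.

Lemma measurable_coord d (i : 'I_d) : measurable_fun setT (fun x : 'rV[R]_d => x ord0 i).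
Proof.
apply: (measurability _ (RGenOpens.measurableE R)) => //.
move=> _ [_ [a [b ->] <-]]; rewrite setTI; apply: measurable_open.
apply: open_comp; last exact: interval_open.
by move=> x _; exact: coord_continuous.
Qed.

(** Every open set is a countable union of rational boxes, and the preimage of a box is a finite
    intersection of coordinate preimages. *)
Lemma measurable_fun_coord dT (T : measurableType dT) d (f : T -> 'rV[R]_d) :
  (forall i, measurable_fun setT (fun t => f t ord0 i)) -> measurable_fun setT f.
Proof.
move=> mf; apply: (measurability (open : set (set 'rV[R]_d))) => //.
move=> _ [U oU <-]; rewrite setTI (open_ratball _ _ oU) preimage_bigcup.
apply: bigcup_count_measurable => c _.
rewrite ratballE preimage_bigcap; apply: fin_bigcap_measurable; first exact: finite_finset.
move=> i _; rewrite -[X in measurable X]setTI; apply: mf => //.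
by apply: open_measurable; exact: ball_open.
Qed.

Lemma measurable_ratball d c : measurable (ratball d c).
Proof.
rewrite ratballE; apply: fin_bigcap_measurable; first exact: finite_finset.
move=> i _; rewrite -[X in measurable X]setTI; apply: measurable_coord => //.
by apply: open_measurable; exact: ball_open.
Qed.

Lemma measurable_coord_comp dT (T : measurableType dT) d (f : T -> 'rV[R]_d) i :
  measurable_fun setT f -> measurable_fun setT (fun t => f t ord0 i).
Proof. by move=> mf; exact: (measurableT_comp (measurable_coord _ i)). Qed.

Lemma measurable_dotv dT (T : measurableType dT) d (f g : T -> 'rV[R]_d) :
  measurable_fun setT f -> measurable_fun setT g ->
  measurable_fun setT (fun t => dotv (f t) (g t)).
Proof.
move=> mf mg; apply: measurable_sum => i.
by apply: measurable_funM; exact: measurable_coord_comp.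
Qed.

Lemma measurable_subv dT (T : measurableType dT) d (f g : T -> 'rV[R]_d) :
  measurable_fun setT f -> measurable_fun setT g ->
  measurable_fun setT (fun t => f t - g t).
Proof.
move=> mf mg; apply: measurable_fun_coord => i.
under eq_fun do rewrite !mxE.
by apply: measurable_funB; exact: measurable_coord_comp.
Qed.

Lemma measurable_scalev dT (T : measurableType dT) d (a : R) (f : T -> 'rV[R]_d) :
  measurable_fun setT f -> measurable_fun setT (fun t => a *: f t).
Proof.
move=> mf; apply: measurable_fun_coord => i.
under eq_fun do rewrite !mxE.
by apply: measurable_funM => //; exact: measurable_coord_comp.
Qed.

Lemma measurable_sqnorm dT (T : measurableType dT) d (f : T -> 'rV[R]_d) :
  measurable_fun setT f -> measurable_fun setT (fun t => sqnorm (f t)).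
Proof. by move=> mf; exact: measurable_dotv. Qed.

Lemma sqnorm_ge0 d (x : 'rV[R]_d) : 0 <= sqnorm x.
Proof. by apply: sumr_ge0 => i _; rewrite -expr2 sqr_ge0. Qed.

Lemma sqnorm_eq0 d (x : 'rV[R]_d) : sqnorm x = 0 -> x = 0.
Proof.
move=> /eqP; rewrite psumr_eq0; last by move=> i _; rewrite -expr2 sqr_ge0.
move=> /allP h; apply/rowP => i; rewrite mxE; apply/eqP.
by have := h i (mem_index_enum i); rewrite /= -expr2 sqrf_eq0.
Qed.

Lemma sqnormB d (x y : 'rV[R]_d) : sqnorm (x - y) = sqnorm (y - x).
Proof. by apply: eq_bigr => i _; rewrite !mxE; ring. Qed.

End Borel.

(** * Lebesgue measure on R^d *)

(* The library's sigma-finite instance of [\x] is shadowed by the one for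
   subprobabilities, so sigma-finiteness is attached to a copy of the measure. *)
Definition sigma_finite_of d (T : measurableType d) (R : realType)
  (P : {measure set T -> \bar R}) of sigma_finite setT P : set T -> \bar R := P.
HB.instance Definition _ d (T : measurableType d) (R : realType)
  (P : {measure set T -> \bar R}) (sP : sigma_finite setT P) :=
  Measure.copy (@sigma_finite_of _ _ _ P sP) P.
HB.instance Definition _ d (T : measurableType d) (R : realType)
  (P : {measure set T -> \bar R}) (sP : sigma_finite setT P) :=
  Measure_isSigmaFinite.Build _ _ _ (@sigma_finite_of _ _ _ P sP) sP.

Section Lebesgue.
Context {R : realType}.

(** The map through which [lebesgue_rV] is pushed forward from a product; [unconsv] undoes it. *)
Definition consv d (p : measurableTypeR R * 'rV[R]_d) : 'rV[R]_d.+1 :=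
  row_mx (p.1)%:M p.2 : 'rV[R]_(1 + d).

Definition unconsv d (x : 'rV[R]_d.+1) : measurableTypeR R * 'rV[R]_d :=
  (x ord0 ord0, \row_i x ord0 (lift ord0 i)).

Lemma consv0 d p : consv d p ord0 ord0 = p.1.
Proof.
have -> : @ord0 d = lshift d (@ord0 0) by exact: val_inj.
by apply: (etrans (row_mxEl _ _ _ _)); rewrite mxE mulr1n.
Qed.

Lemma consvS d p i : consv d p ord0 (lift ord0 i) = p.2 ord0 i.
Proof.
have -> : lift ord0 i = rshift 1 i by exact: val_inj.
exact: (row_mxEr _ _ _ _).
Qed.

Lemma consvK d : cancel (consv d) (unconsv d).
Proof.
move=> [r y]; rewrite /unconsv consv0; congr pair.
by apply/rowP => i; rewrite mxE consvS.
Qed.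

Lemma measurable_consv d : measurable_fun setT (consv d).
Proof.
apply: measurable_fun_coord => i; have [j ->|->] := unliftP ord0 i.
  under eq_fun do rewrite consvS.
  by apply: measurable_coord_comp; exact: measurable_snd.
by under eq_fun do rewrite consv0; exact: measurable_fst.
Qed.

Definition cube d (n : nat) : set 'rV[R]_d := [set x | forall i, `|x ord0 i| <= n%:R].

Lemma bigcup_cube d : \bigcup_n cube d n = setT.
Proof.
apply/seteqP; split=> // x _.
have xi i : `|x ord0 i| <= \sum_(j < d) `|x ord0 j|.
  by rewrite (bigD1 i)//= lerDl sumr_ge0.
exists (Num.bound (\sum_(j < d) `|x ord0 j|)) => // i.
by rewrite (le_trans (xi i))// ltW// archi_boundP// sumr_ge0.
Qed.

Lemma measurable_cube d n : measurable (cube d n).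
Proof.
rewrite [X in measurable X](_ : _ = \bigcap_(i in [set: 'I_d])
  ((fun x : 'rV[R]_d => x ord0 i) @^-1` `[- n%:R, n%:R])); last first.
  apply/seteqP; split=> x h i; [move=> _|];
    by have := h i; rewrite /= in_itv/= ler_norml// => ->.
apply: fin_bigcap_measurable; first exact: finite_finset.
by move=> i _; rewrite -[X in measurable X]setTI; exact: measurable_coord.
Qed.

Lemma consv_cube d n : consv d @^-1` cube d.+1 n = `[- n%:R, n%:R] `*` cube d n.
Proof.
apply/seteqP; split=> [p h|p [p1 p2] i].
  split=> [|i /=]; last by rewrite -consvS; exact: h.
  by have := h ord0; rewrite consv0 ler_norml /= in_itv.
have [j ->|->] := unliftP ord0 i; first by rewrite consvS; exact: p2.
by rewrite consv0 ler_norml; move: p1; rewrite /= in_itv.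
Qed.

(** [lebesgue_rV] is a bare set function; the induction equips it with a measure structure.
    Finiteness on cubes is carried along because it passes to products and gives the
    sigma-finiteness that the next product relies on. *)
Lemma lebesgue_rV_sigma_finite d :
  exists2 M : {sigma_finite_measure set 'rV[R]_d -> \bar R},
    lebesgue_rV d = M & forall n, (M (cube d n) < +oo)%E.
Proof.
elim: d => [|d [M LM Mfin]].
  exists (\d_(0 : 'rV[R]_0)) => // n.
  by rewrite (le_lt_trans (probability_le1 _ _)) ?ltry//; exact: measurable_cube.
pose P : {measure set 'rV[R]_d.+1 -> \bar R} :=
  measure_function_pushforward__canonical__measure_function_Measure
    (@lebesgue_measure R \x M)%E (measurable_consv d).
have Pfin n : (P (cube d.+1 n) < +oo)%E.
  change ((@lebesgue_measure R \x M)%E (consv d @^-1` cube d.+1 n) < +oo)%E.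
  rewrite consv_cube product_measure1E//; last exact: measurable_cube.
  apply: lte_mul_pinfty => //.
  rewrite ge0_fin_numE//.
  have h : (lebesgue_measure (`[(- n%:R : R)%R, (n%:R : R)%R]%classic : set R) < +oo)%E.
    by rewrite lebesgue_measure_itv /=; case: ifP => // _; rewrite -EFinB ltry.
  exact: h.
have sP : sigma_finite setT P.
  exists (cube d.+1); first by rewrite bigcup_cube.
  by move=> n; split; [exact: measurable_cube|exact: Pfin].
by exists (sigma_finite_of _ _ _ P sP) => //=; rewrite LM.
Qed.

(** Tonelli, by induction on the dimension. If [k] is not the first coordinate, each slice at a
    fixed first coordinate satisfies the hypothesis one dimension lower; otherwise the slices along
    the first coordinate have at most one point. *)
Lemma lebesgue_rV_line0 d (k : 'I_d) (A : set 'rV[R]_d) : measurable A ->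
  (forall x y, A x -> A y -> (forall i, i != k -> x ord0 i = y ord0 i) -> x = y) ->
  lebesgue_rV d A = 0.
Proof.
elim: d k A => [[]//|d IH k A mA Ak].
have [M LM _] := lebesgue_rV_sigma_finite d.
have mB : measurable (consv d @^-1` A).
  by rewrite -[X in measurable X]setTI; exact: measurable_consv.
change ((@lebesgue_measure R \x @lebesgue_rV R d)%E (consv d @^-1` A) = 0).
have [k' kE|kE] := unliftP ord0 k.
  apply: integral0_eq => r _ /=; apply: (IH k').
    exact: measurable_xsection.
  move=> x y /xsectionP Ax /xsectionP Ay xy.
  have := Ak _ _ Ax Ay; rewrite kE => /(_ _)/(congr1 (unconsv d)).
  rewrite !consvK => /(_ _)/(congr1 snd); apply => i.
  have [j ->|->] := unliftP ord0 i; last by rewrite !consv0.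
  by rewrite (inj_eq lift_inj) !consvS; exact: xy.
(* Here [k] is the first coordinate. Uniqueness of the product measure swaps the order of
   integration, so that this coordinate is measured innermost. *)
rewrite LM (@product_measure_unique _ _ _ _ R lebesgue_measure M
  (lebesgue_measure \x^ M)%E)//; last first.
  by move=> C D mC mD; exact: product_measure2E.
apply: integral0_eq => y _ /=.
set S := ysection _ _.
have [->|/set0P[r Sr]] := eqVneq S set0; first by rewrite measure0.
suff -> : S = [set r] by rewrite lebesgue_measure_set1.
apply/seteqP; split=> [r' Sr'|_ -> //]; move: Sr Sr' => /ysectionP Sr /ysectionP Sr'.
have := Ak _ _ Sr Sr'; rewrite kE => /(_ _)/(congr1 (unconsv d)).
rewrite !consvK => /(_ _)/(congr1 fst)/= ->// i.
by have [j ->|->] := unliftP ord0 i; rewrite ?eqxx// !consvS.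
Qed.

End Lebesgue.

(** * Optimal maps and the Wasserstein distance *)

Lemma integral_law d1 d2 (T1 : measurableType d1) (T2 : measurableType d2)
  (R : realType) (m : {measure set T1 -> \bar R}) (n : {measure set T2 -> \bar R})
  (f : T1 -> T2) (h : T2 -> R) :
  measurable_fun setT f -> eq_meas n (pushforward m f) ->
  measurable_fun setT h -> (forall y, 0 <= h y) ->
  (\int[n]_y (h y)%:E = \int[m]_x (h (f x))%:E)%E.
Proof.
move=> mf nf mh h0.
rewrite (@eq_measure_integral _ _ _ _
  (measure_function_pushforward__canonical__measure_function_Measure m mf)); last first.
  by move=> A mA _; exact: nf.
rewrite ge0_integral_pushforward//; last by move=> y _; rewrite lee_fin.
exact: measurableT_comp.
Qed.

Lemma ge0_integral_lin2 d (T : measurableType d) (R : realType)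
  (m : {measure set T -> \bar R}) (a b : R) (f g : T -> R) :
  0 <= a -> 0 <= b ->
  measurable_fun setT f -> (forall y, 0 <= f y) ->
  measurable_fun setT g -> (forall y, 0 <= g y) ->
  (\int[m]_x (a * f x + b * g x)%:E =
   a%:E * \int[m]_x (f x)%:E + b%:E * \int[m]_x (g x)%:E)%E.
Proof.
move=> a0 b0 mf f0 mg g0.
under eq_integral do rewrite EFinD !EFinM.
rewrite ge0_integralD//.
- by rewrite !ge0_integralZl_EFin//; (try exact: measurableT_comp);
    move=> x _; rewrite lee_fin.
- by move=> x _; rewrite -EFinM lee_fin mulr_ge0.
- by apply: measurable_funeM; exact: measurableT_comp.
- by move=> x _; rewrite -EFinM lee_fin mulr_ge0.
- by apply: measurable_funeM; exact: measurableT_comp.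
Qed.

Lemma ge0_integral_eq0 d (T : measurableType d) (R : realType)
  (m : {measure set T -> \bar R}) (f : T -> R) :
  measurable_fun setT f -> (forall y, 0 <= f y) ->
  (\int[m]_x (f x)%:E = 0)%E -> {ae m, forall x, f x = 0}.
Proof.
move=> mf f0 If.
have mEf : measurable_fun setT (EFin \o f) by exact: measurableT_comp.
have [H _] := @ae_eq_integral_abs _ _ _ m setT measurableT (EFin \o f) mEf.
have : ae_eq m setT (EFin \o f) (cst 0%E).
  apply: H; rewrite -[RHS]If; apply: eq_integral => x _ /=.
  by rewrite ger0_norm.
by apply: filterS => x /(_ I)[].
Qed.

Section W2Theory.
Context {R : realType} {d : nat}.
Local Notation V := 'rV[R]_d.
Implicit Types (mu nu : P2 R d).

Lemma W2_ge0 mu nu : 0 <= W2 mu nu.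
Proof. exact: sqrtr_ge0. Qed.

Lemma eq_measC d' (T : measurableType d') (m1 m2 : set T -> \bar R) :
  eq_meas m1 m2 -> eq_meas m2 m1.
Proof. by move=> h A mA; rewrite h. Qed.

Lemma eq_meas_trans d' (T : measurableType d') (m1 m2 m3 : set T -> \bar R) :
  eq_meas m1 m2 -> eq_meas m2 m3 -> eq_meas m1 m3.
Proof. by move=> h k A mA; rewrite h// k. Qed.

Lemma eq_W2 mu mu' nu nu' : eq_meas mu mu' -> eq_meas nu nu' ->
  W2 mu nu = W2 mu' nu'.
Proof.
move=> m n; rewrite /W2; congr (Num.sqrt (fine (ereal_inf _))).
apply/seteqP; split=> _ [g [g1 g2] <-]; exists g => //; split.
- exact: eq_meas_trans g1 m.
- exact: eq_meas_trans g2 n.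
- by apply: eq_meas_trans g1 _; exact: eq_measC.
- by apply: eq_meas_trans g2 _; exact: eq_measC.
Qed.

Lemma sqrW2_le_coupling mu nu (g : probability (V * V)%type R) :
  coupling mu nu g ->
  ((W2 mu nu ^+ 2)%:E <= \int[g]_p (sqnorm (p.1 - p.2))%:E)%E.
Proof.
move=> cg; set I := (X in (_ <= X)%E).
set S := [set (\int[h]_p (sqnorm (p.1 - p.2))%:E)%E | h in coupling mu nu].
have S0 : (0 <= ereal_inf S)%E.
  apply: le_ereal_inf_tmp => _ [h _ <-]; apply: integral_ge0 => p _.
  by rewrite lee_fin sqnorm_ge0.
have SI : (ereal_inf S <= I)%E by apply: ereal_inf_lbound; exists g.
rewrite /W2 sqr_sqrtr; last exact: fine_ge0.
(* An infinite cost makes the claim trivial; a finite one makes the infimum finite, so that [fine]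
   does not fall back on its default 0. *)
have [Ioo|Ioo] := eqVneq I +oo%E; first by rewrite Ioo leey.
rewrite fineK// ge0_fin_numE//; apply: le_lt_trans SI _.
by rewrite ltey.
Qed.

(** The law of the pair (X, Y) is a coupling with this cost. *)
Lemma sqrW2_le d' (T : measurableType d') (P : probability T R) (X Y : T -> V)
  mu nu : measurable_fun setT X -> measurable_fun setT Y ->
  eq_meas mu (pushforward P X) -> eq_meas nu (pushforward P Y) ->
  ((W2 mu nu ^+ 2)%:E <= \int[P]_t (sqnorm (X t - Y t))%:E)%E.
Proof.
move=> mX mY muX nuY.
have mXY : measurable_fun setT (fun t => (X t, Y t)) by exact: measurable_fun_pair.
pose Z : {mfun T >-> (V * V)%type} := mfun_Sub (mem_set mXY).
rewrite -(@integral_law _ _ _ _ _ P (distribution P Z) Z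
   (fun p => sqnorm (p.1 - p.2)))//.
- apply: sqrW2_le_coupling; split=> A mA.
  + by rewrite muX.
  + by rewrite nuY.
- apply: measurable_sqnorm; apply: measurable_subv.
  + exact: measurable_fst.
  + exact: measurable_snd.
- by move=> p; exact: sqnorm_ge0.
Qed.

Lemma W2_refl mu nu : eq_meas mu nu -> W2 mu nu = 0.
Proof.
move=> mn; have := @sqrW2_le _ _ mu id id mu nu.
move=> /(_ (@measurable_id _ _ _) (@measurable_id _ _ _) _ (eq_measC _ _ _ _ mn)).
rewrite integral0_eq => [|x _]; last first.
  by rewrite subrr /sqnorm /dotv big1// => i _; rewrite mxE mul0r.
by rewrite lee_fin exprn_even_le0//= => /(_ (fun _ _ => erefl))/eqP.
Qed.

(** Measures equal on Borel sets are at distance 0. If F were larger at one of them, lower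
    semicontinuity there, with the value at the other as level, would be contradictory. *)
Lemma eq_meas_F (F : P2 R d -> \bar R) mu nu :
  (forall m, F m != -oo%E) -> W2_lsc F -> eq_meas mu nu -> F mu = F nu.
Proof.
move=> F_ninfty lscF.
suff H (m m' : P2 R d) : eq_meas m m' -> (F m' <= F m)%E.
  by move=> mn; apply/eqP; rewrite eq_le !H//; exact: eq_measC.
move=> mm'; rewrite leNgt; apply/negP => FF.
case Fm : (F m) FF => [a| |] FF; [|by rewrite ltNge leey in FF|].
  have [e e0 /(_ m)] := lscF _ _ FF.
  by rewrite Fm ltxx (W2_refl m' m)//; [move=> /(_ e0)|exact: eq_measC].
by have := F_ninfty m; rewrite Fm.
Qed.

Lemma is_pushforward_comp mu nu rho (t u : V -> V) :
  is_pushforward t mu nu -> is_pushforward u nu rho ->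
  is_pushforward (u \o t) mu rho.
Proof.
move=> [mt mnu] [mu_ nrho]; split; first exact: measurableT_comp.
move=> A mA; rewrite nrho// /pushforward mnu// -[X in measurable X]setTI.
exact: mu_.
Qed.

Lemma ot_cost_comp mu nu rho (t u : V -> V) :
  is_pushforward t mu nu -> is_ot_map nu rho u ->
  (\int[mu]_x (sqnorm (t x - u (t x)))%:E = (W2 nu rho ^+ 2)%:E)%E.
Proof.
move=> [mt nt] [[mu_ _] <-].
rewrite -(@integral_law _ _ _ _ _ mu nu t (fun x => sqnorm (x - u x)))//.
  by apply: measurable_sqnorm; exact: measurable_subv.
by move=> y; exact: sqnorm_ge0.
Qed.

Lemma W2_sym_ot mu nu t : is_ot_map mu nu t -> W2 nu mu <= W2 mu nu.
Proof.
move=> [[mt nt] It].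
rewrite -(@ler_pXn2r _ 2)// ?nnegrE ?W2_ge0// -lee_fin -It.
have := @sqrW2_le _ _ mu t id nu mu mt (@measurable_id _ _ _) nt (fun _ _ => erefl).
move=> /le_trans; apply; rewrite le_eqVlt; apply/orP; left; apply/eqP.
by apply: eq_integral => x _; rewrite sqnormB.
Qed.

(** Young's inequality with its defect as an explicit square, so that the equality case can be read
    off. The factor 1 fits the shape of [ge0_integral_lin2]. *)
Lemma sqnorm_young (s : R) (x y : V) : 0 < s < 1 ->
  1 * sqnorm (x + y) + (s * (1 - s))^-1 * sqnorm ((1 - s) *: x - s *: y) =
  s^-1 * sqnorm x + (1 - s)^-1 * sqnorm y.
Proof.
move=> /andP[s0 s1]; rewrite /sqnorm /dotv !mulr_sumr -!big_split /=.
apply: eq_bigr => i _; rewrite !mxE; field.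
by rewrite subr_eq0 !gt_eqF.
Qed.

Lemma ot_young (s : R) mu nu rho t u : 0 < s < 1 ->
  is_ot_map mu nu t -> is_ot_map nu rho u ->
  (\int[mu]_x (sqnorm (x - u (t x)))%:E + (s * (1 - s))^-1%:E *
     \int[mu]_x (sqnorm ((1 - s) *: (x - t x) - s *: (t x - u (t x))))%:E =
  (s^-1 * W2 mu nu ^+ 2 + (1 - s)^-1 * W2 nu rho ^+ 2)%:E)%E.
Proof.
move=> s01 [pt It] ou; have [s0 s1] := andP s01.
have [mt _] := pt; have [[mu_ _] _] := ou.
have mut : measurable_fun setT (u \o t) by exact: measurableT_comp.
have mX : measurable_fun setT (fun x : V => x - t x) by exact: measurable_subv.
have mY : measurable_fun setT (fun x : V => t x - u (t x)) by exact: measurable_subv.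
have mXY : measurable_fun setT (fun x : V => x - u (t x)) by exact: measurable_subv.
rewrite -[X in (X + _)%E]mul1e -ge0_integral_lin2//; first last.
- by move=> y; exact: sqnorm_ge0.
- by apply: measurable_sqnorm; apply: measurable_subv; exact: measurable_scalev.
- by move=> y; exact: sqnorm_ge0.
- exact: measurable_sqnorm.
- by rewrite invr_ge0 mulr_ge0// ?subr_ge0 ltW.
under eq_integral => x _.
  rewrite -{1}[x in sqnorm (x - _)](subrK (t x)) -addrA sqnorm_young//.
  over.
rewrite ge0_integral_lin2//; first last.
- by move=> y; exact: sqnorm_ge0.
- exact: measurable_sqnorm.
- by move=> y; exact: sqnorm_ge0.
- exact: measurable_sqnorm.
- by rewrite invr_ge0 subr_ge0 ltW.
- by rewrite invr_ge0 ltW.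
by rewrite It (ot_cost_comp _ _ _ _ _ pt ou) EFinD !EFinM.
Qed.

(** The composed map couples [mu] with [rho]; its cost is bounded by Young's inequality at the
    optimal ratio s = p / (p + q), up to [e]. *)
Lemma W2_triangle_ot mu nu rho t u :
  is_ot_map mu nu t -> is_ot_map nu rho u ->
  W2 mu rho <= W2 mu nu + W2 nu rho.
Proof.
move=> ot ou; apply/ler_addgt0Pr => e e0.
set p := W2 mu nu; set q := W2 nu rho.
have p0 : 0 <= p := W2_ge0 _ _; have q0 : 0 <= q := W2_ge0 _ _.
have [pt It] := ot; have [pu Iu] := ou.
have [mt _] := pt; have [mu_ _] := pu.
(* Adding e / 2 to both distances keeps [s] strictly between 0 and 1 even when a distance
   vanishes. *)
pose P := p + e / 2; pose Q := q + e / 2.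
have e20 : 0 < e / 2 by rewrite divr_gt0.
have P0 : 0 < P by rewrite ltr_wpDl.
have Q0 : 0 < Q by rewrite ltr_wpDl.
have PQ0 : 0 < P + Q by rewrite addr_gt0.
pose s := P / (P + Q).
have s01 : 0 < s < 1 by rewrite divr_gt0//= ltr_pdivrMr// mul1r ltrDl.
rewrite -[leRHS](_ : P + Q = _); last by rewrite /P /Q; field.
rewrite -(@ler_pXn2r _ 2)// ?nnegrE ?W2_ge0 ?(ltW PQ0)// -lee_fin.
have [_ put] := is_pushforward_comp _ _ _ _ _ pt pu.
apply: le_trans (sqrW2_le _ _ mu id (u \o t) mu rho _ _ _ put) _ => //.
  exact: measurableT_comp.
have := ot_young s mu nu rho t u s01 ot ou; set J := (X in (_ + _ * X)%E) => H.
have J0 : (0 <= ((s * (1 - s))^-1)%:E * J)%E.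
  apply: mule_ge0; last by apply: integral_ge0 => x _; rewrite lee_fin sqnorm_ge0.
  have [s0 s1] := andP s01.
  by rewrite lee_fin invr_ge0 mulr_ge0// ?subr_ge0 ltW.
apply: (@le_trans _ _ (s^-1 * p ^+ 2 + (1 - s)^-1 * q ^+ 2)%:E).
  by rewrite -H leeDl.
rewrite lee_fin.
have -> : (P + Q) ^+ 2 = s^-1 * P ^+ 2 + (1 - s)^-1 * Q ^+ 2.
  by rewrite /s; field; rewrite [P + Q - P]addrC addKr !lt0r_neq0.
have [s0 s1] := andP s01.
apply: lerD; apply: ler_wpM2l.
- by rewrite invr_ge0 ltW.
- by rewrite ler_pXn2r ?nnegrE ?(ltW P0)// /P lerDl ltW.
- by rewrite invr_ge0 subr_ge0 ltW.
- by rewrite ler_pXn2r ?nnegrE ?(ltW Q0)// /Q lerDl ltW.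
Qed.

(* Equality in the Young inequality forces both displacements to be parallel. *)
Lemma ot_through_geodesic (s : R) mu nu rho t u : 0 < s < 1 ->
  W2 mu nu = s * W2 mu rho -> W2 nu rho = (1 - s) * W2 mu rho ->
  is_ot_map mu nu t -> is_ot_map nu rho u ->
  is_ot_map mu rho (u \o t) /\
  {ae mu, forall x, t x - x = s *: (u (t x) - x)}.
Proof.
move=> s01 Wn Wr ot ou; have [s0 s1] := andP s01.
have [pt It] := ot; have [pu Iu] := ou.
have [mt _] := pt; have [mu_ _] := pu.
have put := is_pushforward_comp _ _ _ _ _ pt pu.
have mut : measurable_fun setT (u \o t) by exact: measurableT_comp.
have := ot_young s mu nu rho t u s01 ot ou.
(* With distances s W and (1 - s) W, the right-hand side of Young's identity is exactly W^2. The
   composed map costs at least W^2, so the defect integral [J] must vanish. *)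
rewrite Wn Wr (_ : _ * _ + _ = W2 mu rho ^+ 2); last first.
  by field; rewrite subr_eq0 !gt_eqF.
set I := (X in (X + _)%E); set J := (X in (_ + _ * X)%E) => IJ.
have k0 : 0 < (s * (1 - s))^-1 by rewrite invr_gt0 mulr_gt0// subr_gt0.
have J0 : (0 <= J)%E by apply: integral_ge0 => x _; rewrite lee_fin sqnorm_ge0.
have WI : ((W2 mu rho ^+ 2)%:E <= I)%E.
  by apply: (@sqrW2_le _ _ mu id (u \o t)) => //; have [] := put.
have kJ0 : (0 <= ((s * (1 - s))^-1)%:E * J)%E by rewrite mule_ge0// lee_fin ltW.
have IW : I = (W2 mu rho ^+ 2)%:E.
  by apply/eqP; rewrite eq_le WI andbT -IJ leeDl.
split; first by split.
have : (((s * (1 - s))^-1)%:E * J = 0)%E.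
  move: IJ; rewrite IW; case: (X in (_ + X)%E) => [r| |]//= [].
  by move=> /eqP; rewrite -[eqbRHS]addr0 (inj_eq (addrI _)) => /eqP ->.
move=> /eqP; rewrite mule_eq0 eqe gt_eqF//= => /eqP /ge0_integral_eq0.
have mE : measurable_fun setT
    (fun x : V => sqnorm ((1 - s) *: (x - t x) - s *: (t x - u (t x)))).
  by apply: measurable_sqnorm; apply: measurable_subv; apply: measurable_scalev;
    exact: measurable_subv.
move=> /(_ mE (fun y => sqnorm_ge0 _ _)); apply: filterS.
move=> x /sqnorm_eq0/rowP E; apply/rowP => i; have := E i; rewrite !mxE => {}E.
lra.
Qed.

End W2Theory.

(** * Uniqueness of optimal maps *)

Section ProbabilityConstructions.
Context {R : realType} {d} {T : measurableType d}.
Implicit Types P Q : probability T R.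

Definition prob_square P : set (T * T) -> \bar R := (P \x P)%E.
HB.instance Definition _ P := Measure.copy (prob_square P) (P \x P)%E.

Lemma prob_square_rect P A B : measurable A -> measurable B ->
  prob_square P (A `*` B) = (P A * P B)%E.
Proof. exact: product_measure1E. Qed.

Let prob_square_setT P : prob_square P setT = 1%E.
Proof. by rewrite -setXTT prob_square_rect// probability_setT mule1. Qed.
HB.instance Definition _ P :=
  Measure_isProbability.Build _ _ _ (prob_square P) (prob_square_setT P).

Lemma prob_square_fst P : eq_meas P (pushforward (prob_square P) fst).
Proof.
move=> A mA; rewrite /pushforward (_ : fst @^-1` A = A `*` setT).
  by rewrite prob_square_rect// probability_setT mule1.
by apply/seteqP; split=> x // [].
Qed.

Lemma prob_square_snd P : eq_meas P (pushforward (prob_square P) snd).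
Proof.
move=> A mA; rewrite /pushforward (_ : snd @^-1` A = setT `*` A).
  by rewrite prob_square_rect// probability_setT mul1e.
by apply/seteqP; split=> x // [].
Qed.

Definition prob_mix P Q : set T -> \bar R :=
  measure_add (mscale (2^-1 : R)%:nng P) (mscale (2^-1 : R)%:nng Q).
HB.instance Definition _ P Q := Measure.copy (prob_mix P Q)
  (measure_add (mscale (2^-1 : R)%:nng P) (mscale (2^-1 : R)%:nng Q)).

Lemma prob_mixE P Q A : prob_mix P Q A = (2^-1%:E * P A + 2^-1%:E * Q A)%E.
Proof. exact: measure_addE. Qed.

Let prob_mix_setT P Q : prob_mix P Q setT = 1%E.
Proof.
by rewrite prob_mixE !probability_setT !mule1 -EFinD [in RHS](splitr 1) mul1r.
Qed.
HB.instance Definition _ P Q :=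
  Measure_isProbability.Build _ _ _ (prob_mix P Q) (prob_mix_setT P Q).

Lemma ge0_integral_prob_mix P Q (f : T -> R) : measurable_fun setT f ->
  (forall x, 0 <= f x) ->
  (\int[prob_mix P Q]_x (f x)%:E =
   2^-1%:E * \int[P]_x (f x)%:E + 2^-1%:E * \int[Q]_x (f x)%:E)%E.
Proof.
move=> mf f0; have mEf : measurable_fun setT (EFin \o f) by exact: measurableT_comp.
rewrite ge0_integral_measure_add//; last by move=> x _; rewrite lee_fin.
by rewrite !ge0_integral_mscale// => x _; rewrite lee_fin.
Qed.

End ProbabilityConstructions.

Section Uniqueness.
Context {R : realType} {d : nat}.
Local Notation V := 'rV[R]_d.
Implicit Types (m n : P2 R d).

Lemma measurable_half_sum dT (T : measurableType dT) (f g : T -> R) :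
  measurable_fun setT f -> measurable_fun setT g ->
  measurable_fun setT (fun x => 2^-1 * f x + 2^-1 * g x).
Proof. by move=> mf mg; apply: measurable_funD; apply: measurable_funM. Qed.

(* Exchanging the images of x and y whenever the pair violates monotonicity
   yields, after averaging the two coordinates, another coupling; it would be
   strictly cheaper if violations had positive probability. *)
Lemma ot_maps_monotone_ae m n (v1 v2 : V -> V) :
  is_ot_map m n v1 -> is_ot_map m n v2 ->
  {ae (prob_square m), forall p, 0 <= dotv (p.1 - p.2) (v1 p.1 - v2 p.2)}.
Proof.
move=> [[mv1 nv1] Iv1] [[mv2 nv2] Iv2].
pose P : probability (V * V)%type R := prob_square m.
have mfst : measurable_fun setT (fst : V * V -> V) by exact: measurable_fst.
have msnd : measurable_fun setT (snd : V * V -> V) by exact: measurable_snd.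
have mv1f : measurable_fun setT (v1 \o fst : V * V -> V) by exact: measurableT_comp.
have mv2s : measurable_fun setT (v2 \o snd : V * V -> V) by exact: measurableT_comp.
pose D (p : V * V) := dotv (p.1 - p.2) (v1 p.1 - v2 p.2).
have mD : measurable_fun setT D.
  by apply: measurable_dotv; exact: measurable_subv.
pose b (p : V * V) := D p < 0.
have mb : measurable_fun setT b by exact: measurable_fun_ltr.
pose Y1 (p : V * V) := if b p then v2 p.2 else v1 p.1.
pose Y2 (p : V * V) := if b p then v1 p.1 else v2 p.2.
have mY1 : measurable_fun setT Y1 by exact: measurable_fun_ifT.
have mY2 : measurable_fun setT Y2 by exact: measurable_fun_ifT.
have mZ1 : measurable_fun setT (fun p : V * V => (p.1, Y1 p)).
  exact: measurable_fun_pair.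
have mZ2 : measurable_fun setT (fun p : V * V => (p.2, Y2 p)).
  exact: measurable_fun_pair.
pose Z1 : {mfun (V * V)%type >-> (V * V)%type} := mfun_Sub (mem_set mZ1).
pose Z2 : {mfun (V * V)%type >-> (V * V)%type} := mfun_Sub (mem_set mZ2).
pose g : probability (V * V)%type R := prob_mix (distribution P Z1) (distribution P Z2).
have gE A : g A = (2^-1%:E * P (Z1 @^-1` A) + 2^-1%:E * P (Z2 @^-1` A))%E.
  exact: prob_mixE.
have half (x : \bar R) : (2^-1%:E * x + 2^-1%:E * x = x)%E.
  rewrite -ge0_muleDl ?lee_fin ?invr_ge0// -EFinD (_ : _ + _ = 1) ?mul1e//.
  by rewrite [RHS]splitr mul1r.
have msub (A : set V) (h : V * V -> V) :
    measurable_fun setT h -> measurable A -> measurable (h @^-1` A).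
  by move=> mh mA; rewrite -[X in measurable X]setTI; exact: mh.
have cg : coupling m n g.
  split=> A mA; apply/esym; rewrite /pushforward gE.
    have h1 : P (fst @^-1` A) = m A by rewrite (prob_square_fst m A mA).
    have h2 : P (snd @^-1` A) = m A by rewrite (prob_square_snd m A mA).
    change (m A = 2^-1%:E * P (fst @^-1` A) + 2^-1%:E * P (snd @^-1` A))%E.
    by rewrite h1 h2 half.
  have h1 : P ((v1 \o fst) @^-1` A) = n A.
    rewrite nv1// /pushforward (prob_square_fst m (v1 @^-1` A))//.
    by rewrite -[X in measurable X]setTI; exact: mv1.
  have h2 : P ((v2 \o snd) @^-1` A) = n A.
    rewrite nv2// /pushforward (prob_square_snd m (v2 @^-1` A))//.
    by rewrite -[X in measurable X]setTI; exact: mv2.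
  (* Separately, [Y1] and [Y2] need not have law [n]. At each p they permute [v1 p.1] and [v2 p.2],
     so the sum of their two indicators is unchanged by the exchange. *)
  change (n A = 2^-1%:E * P (Y1 @^-1` A) + 2^-1%:E * P (Y2 @^-1` A))%E.
  transitivity (2^-1%:E * P ((v1 \o fst) @^-1` A) + 2^-1%:E * P ((v2 \o snd) @^-1` A))%E.
    by rewrite h1 h2 half.
  have indP (h : V * V -> V) : measurable_fun setT h ->
      P (h @^-1` A) = (\int[P]_p (\1_(h @^-1` A) p)%:E)%E.
    by move=> mh; rewrite integral_indic// ?setIT//; exact: msub.
  rewrite !indP// -!ge0_integral_lin2//; try by move=> p; rewrite indicE.
  all: try by apply: measurable_indic; exact: msub.
  apply: eq_integral => p _; congr (_%:E).
  have indE (h : V * V -> V) : \1_(h @^-1` A) p = \1_A (h p) :> R by [].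
  by rewrite !indE /Y1 /Y2/=; case: (b p); rewrite //= addrC.
have msq (h k : V * V -> V) : measurable_fun setT h -> measurable_fun setT k ->
    measurable_fun setT (fun p => sqnorm (h p - k p)).
  by move=> mh mk; apply: measurable_sqnorm; exact: measurable_subv.
have mc : measurable_fun setT (fun p : V * V => sqnorm (p.1 - p.2)) by exact: msq.
have := sqrW2_le_coupling _ _ _ cg.
rewrite (ge0_integral_prob_mix _ _ _ mc); last by move=> p; exact: sqnorm_ge0.
rewrite !ge0_integral_distribution//; try by move=> p; rewrite lee_fin sqnorm_ge0.
all: try by apply: measurableT_comp.
rewrite -ge0_integral_lin2//; try by move=> p; exact: sqnorm_ge0.
all: try exact: msq.
set f' := fun p : V * V => 2^-1 * sqnorm (p.1 - Y1 p) + 2^-1 * sqnorm (p.2 - Y2 p).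
move=> Wf'.
pose f (p : V * V) := 2^-1 * sqnorm (p.1 - v1 p.1) + 2^-1 * sqnorm (p.2 - v2 p.2).
have If : (\int[P]_p (f p)%:E = (W2 m n ^+ 2)%:E)%E.
  rewrite ge0_integral_lin2//; try by move=> p; exact: sqnorm_ge0.
  all: try exact: msq.
  rewrite -(integral_law _ _ _ _ _ P m fst (fun x => sqnorm (x - v1 x)))//; last 3 first.
  - exact: prob_square_fst.
  - by apply: measurable_sqnorm; exact: measurable_subv.
  - by move=> y; exact: sqnorm_ge0.
  rewrite -(integral_law _ _ _ _ _ P m snd (fun x => sqnorm (x - v2 x)))//; last 3 first.
  - exact: prob_square_snd.
  - by apply: measurable_sqnorm; exact: measurable_subv.
  - by move=> y; exact: sqnorm_ge0.
  by rewrite Iv1 Iv2 half.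
(* [k] is the cost saved by the exchange: expanding the squares gives f - f' = - D wherever images
   are swapped. *)
pose k (p : V * V) := if b p then - D p else 0.
have k0 p : 0 <= k p by rewrite /k /b; case: ltP => // /ltW; rewrite oppr_ge0.
have f'0 p : 0 <= f' p by rewrite addr_ge0// mulr_ge0// ?invr_ge0// sqnorm_ge0.
have mk : measurable_fun setT k.
  by apply: measurable_fun_ifT => //; exact: measurableT_comp.
have mf' : measurable_fun setT f' by apply: measurable_half_sum; exact: msq.
have fE p : f p = 1 * f' p + 1 * k p.
  rewrite !mul1r /f /f' /k /Y1 /Y2; case: (b p) => /=; last by rewrite addr0.
  rewrite /D /sqnorm /dotv !mulr_sumr -sumrN -!big_split/=.
  by apply: eq_bigr => i _; rewrite !mxE; field.
have : (\int[P]_p (f p)%:E = \int[P]_p (f' p)%:E + \int[P]_p (k p)%:E)%E.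
  under eq_integral do rewrite fE.
  by rewrite ge0_integral_lin2// !mul1e.
rewrite If => E.
(* As [g] is a coupling, W2^2 is at most the integral of [f']; it also equals that integral plus the
   integral of [k], so nothing can be saved. *)
have Ik : (\int[P]_p (k p)%:E = 0)%E.
  have : (0 <= \int[P]_p (k p)%:E)%E by apply: integral_ge0 => p _; rewrite lee_fin.
  move: E Wf'; case: (\int[P]_p (f' p)%:E)%E => [r| |]//;
    case: (\int[P]_p (k p)%:E)%E => [s| |]//.
  rewrite -EFinD => -[->]; rewrite !lee_fin gerDl => s0 s0'.
  by congr (_%:E); apply/eqP; rewrite eq_le s0.
have := ge0_integral_eq0 _ _ _ _ k mk k0 Ik.
apply: filterS => p; rewrite /k /b; case: ltP => // Dp /eqP.
by rewrite oppr_eq0 lt_eqF.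
Qed.

Lemma negligible_bigcup_count dT (T : measurableType dT) (I : countType)
  (mu : {measure set T -> \bar R}) (D : set I) (F : I -> set T) :
  (forall i, D i -> mu.-negligible (F i)) ->
  mu.-negligible (\bigcup_(i in D) F i).
Proof.
move=> F0; rewrite [X in mu.-negligible X](_ : _ =
    \bigcup_n (if unpickle n is Some i then if i \in D then F i else set0 else set0)).
  apply: negligible_bigcup => n; case: unpickle => [i|]; last exact: negligible_set0.
  by case: ifPn => [/set_mem/F0|_] //; exact: negligible_set0.
apply/seteqP; split=> [x [i Di Fix]|x [n _]].
  by exists (pickle i) => //; rewrite pickleK mem_set.
by case: unpickle => // i; case: ifPn => // /set_mem Di Fi; exists i.
Qed.

(** For c = (k, q, N), the k-th coordinates are separated by the rational q with margin 1/(N+1), and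
    N also bounds all coordinates of both images. Countably many such sets, taken in both orders of
    the maps, cover the points of disagreement. *)
Definition gap_set (v1 v2 : V -> V) (c : 'I_d * rat * nat) : set V :=
  [set x | [/\ v1 x ord0 c.1.1 < ratr c.1.2,
    ratr c.1.2 + c.2.+1%:R^-1 < v2 x ord0 c.1.1 &
    forall i, `|v1 x ord0 i| <= c.2%:R /\ `|v2 x ord0 i| <= c.2%:R]].

Lemma neq_sub_gap_set (v1 v2 : V -> V) :
  [set x | v1 x != v2 x] `<=`
  (\bigcup_c gap_set v1 v2 c) `|` (\bigcup_c gap_set v2 v1 c).
Proof.
have H (w1 w2 : V -> V) x k : w1 x ord0 k < w2 x ord0 k -> exists c, gap_set w1 w2 c x.
  move=> /rat_in_itvoo[q]; rewrite in_itv/= => /andP[q1 q2].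
  pose S := \sum_i (`|w1 x ord0 i| + `|w2 x ord0 i|).
  have S0 i : `|w1 x ord0 i| + `|w2 x ord0 i| <= S.
    by rewrite /S (bigD1 i)//= lerDl sumr_ge0// => j _; rewrite addr_ge0.
  pose e := w2 x ord0 k - ratr q.
  have e0 : 0 < e by rewrite subr_gt0.
  (* A single N must be large enough for the bound and have a small enough inverse for the gap. *)
  pose N := maxn (Num.bound S) (Num.bound e^-1).
  have SN : S <= N%:R.
    rewrite (@le_trans _ _ (Num.bound S)%:R)//; last by rewrite ler_nat leq_maxl.
    by rewrite ltW// archi_boundP// (le_trans _ (S0 k))// addr_ge0.
  exists (k, q, N); split=> //=.
    rewrite -ltrBrDl -/e invf_plt ?posrE//.
    rewrite (@lt_le_trans _ _ (Num.bound e^-1)%:R)//.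
      by rewrite archi_boundP// invr_ge0 ltW.
    by rewrite ler_nat (leq_trans (leq_maxr _ _) (leqnSn _)).
  move=> i; split; rewrite (le_trans _ SN)// (le_trans _ (S0 i))//.
    by rewrite lerDl.
  by rewrite lerDr.
move=> x /eqP vx.
have [k vk] : exists k, v1 x ord0 k != v2 x ord0 k.
  apply: contrapT => /forallNP h; apply: vx; apply/rowP => i.
  by have /negP := h i; rewrite negbK => /eqP.
move: vk; rewrite neq_lt => /orP[/H|/H] [c hc]; [left|right]; by exists c.
Qed.

Lemma measurable_gap_set (v1 v2 : V -> V) c :
  measurable_fun setT v1 -> measurable_fun setT v2 -> measurable (gap_set v1 v2 c).
Proof.
move=> m1 m2.
have mc (v : V -> V) i : measurable_fun setT v -> measurable_fun setT (fun x => v x ord0 i).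
  exact: measurable_coord_comp.
rewrite [X in measurable X](_ : _ =
  ((fun x => v1 x ord0 c.1.1) @^-1` `]-oo, ratr c.1.2[) `&`
  ((fun x => v2 x ord0 c.1.1) @^-1` `]ratr c.1.2 + c.2.+1%:R^-1, +oo[) `&`
  \bigcap_(i in [set: 'I_d])
    (((fun x => v1 x ord0 i) @^-1` `[- c.2%:R, c.2%:R]) `&`
     ((fun x => v2 x ord0 i) @^-1` `[- c.2%:R, c.2%:R]))).
  have pre (v : V -> V) i (I : interval R) : measurable_fun setT v ->
      measurable ((fun x => v x ord0 i) @^-1` [set` I]).
    move=> mv; rewrite -[X in measurable X]setTI; apply: mc => //.
  apply: measurableI; first by apply: measurableI; exact: pre.
  apply: fin_bigcap_measurable; first exact: finite_finset.
  by move=> i _; apply: measurableI; exact: pre.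
apply/seteqP; split=> [x [h1 h2 h3]|x [[h1 h2] h3]].
  split; first by split; rewrite /= in_itv/= ?andbT.
  by move=> i _; have [] := h3 i; split; rewrite /= in_itv/= -ler_norml.
split; [by move: h1; rewrite /= in_itv|by move: h2; rewrite /= in_itv/= andbT|].
by move=> i; have [] := h3 i I; rewrite /= !in_itv/= -!ler_norml.
Qed.

(** In coordinate k, z exceeds z' by at least h - 2 rho while the images are in reverse order with
    margin 1/(N+1). Every other term is at most 2 rho times 2 N, because x and y agree there. *)
Lemma gap_set_dotv (v1 v2 : V -> V) c (x y z z' : V) (rho : R) :
  (forall i, i != c.1.1 -> x ord0 i = y ord0 i) ->
  0 < rho -> 2 * rho < y ord0 c.1.1 - x ord0 c.1.1 ->
  4 * d%:R * rho * c.2%:R < (y ord0 c.1.1 - x ord0 c.1.1 - 2 * rho) * c.2.+1%:R^-1 ->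
  (forall i, `|y ord0 i - z ord0 i| < rho) ->
  (forall i, `|x ord0 i - z' ord0 i| < rho) ->
  gap_set v1 v2 c z -> gap_set v1 v2 c z' ->
  dotv (z - z') (v1 z - v2 z') < 0.
Proof.
case: c => -[k q] N /=; set h := y ord0 k - x ord0 k.
move=> xy rho0 hrho hN yz xz' [/= a1 _ a3] [/= _ b2 b3].
rewrite /dotv (bigD1 k)//= !mxE.
set A := (X in X + _); set B := (X in _ + X).
have AE : A <= - ((h - 2 * rho) * N.+1%:R^-1).
  have := yz k; have := xz' k; rewrite !ltr_norml => /andP[x1 x2] /andP[y1 y2].
  rewrite /A -[X in _ <= X]mulrN.
  have g1 : h - 2 * rho <= z ord0 k - z' ord0 k by rewrite /h; lra.
  have g2 : v1 z ord0 k - v2 z' ord0 k <= - N.+1%:R^-1.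
    by move: b2; set e := N.+1%:R^-1; lra.
  have g3 : v1 z ord0 k - v2 z' ord0 k <= 0.
    by rewrite (le_trans g2)// oppr_le0 invr_ge0.
  apply: (@le_trans _ _ ((h - 2 * rho) * (v1 z ord0 k - v2 z' ord0 k))).
    by rewrite ler_wnM2r.
  by rewrite ler_wpM2l// subr_ge0 ltW.
have BE : B <= 4 * d%:R * rho * N%:R.
  apply: (@le_trans _ _ (\sum_(i < d | i != k) (4 * rho * N%:R))).
    apply: ler_sum => i ik; rewrite !mxE.
    apply: le_trans (ler_norm _) _; rewrite normrM.
    rewrite (_ : 4 * rho * N%:R = (2 * rho) * (2 * N%:R)); last by ring.
    apply: ler_pM => //.
      have := yz i; have := xz' i; rewrite (xy i ik).
      by rewrite !ltr_norml ler_norml => /andP[x1 x2] /andP[y1 y2]; apply/andP; split; lra.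
    rewrite (le_trans (ler_normB _ _))//.
    by have [h1 _] := a3 i; have [_ h2] := b3 i; rewrite mulr_natl mulr2n lerD.
  apply: (@le_trans _ _ (\sum_(i < d) (4 * rho * N%:R))).
    by rewrite [leRHS](bigD1 k)//= lerDr !mulr_ge0// ltW.
  by rewrite sumr_const card_ord -mulr_natr le_eqVlt; apply/orP; left; apply/eqP; ring.
rewrite -[ltRHS](addNr ((h - 2 * rho) * N.+1%:R^-1)) ler_ltD//.
exact: le_lt_trans BE hN.
Qed.

(** Remove from the gap set the boxes in which it has no mass. Around two remaining points on a line
    in direction e_k, small boxes carry positive mass and, by [gap_set_dotv], violate monotonicity
    throughout, against [ot_maps_monotone_ae]. The rest is therefore Lebesgue-null, hence
    [m]-null. *)
Lemma gap_set_null m n (v1 v2 : V -> V) c : m `<< lebesgue_rV d ->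
  is_ot_map m n v1 -> is_ot_map m n v2 -> m.-negligible (gap_set v1 v2 c).
Proof.
move=> m_ac o1 o2; have [[m1 _] _] := o1; have [[m2 _] _] := o2.
set E := gap_set v1 v2 c.
have mE : measurable E by exact: measurable_gap_set.
pose Z := [set r | m (ratball d r `&` E) = 0%E].
pose N := \bigcup_(r in Z) (ratball d r `&` E).
have mB r : measurable (ratball d r `&` E).
  by apply: measurableI => //; exact: measurable_ratball.
have mN : measurable N by apply: bigcup_count_measurable => r _; exact: mB.
have N0 : m.-negligible N.
  by apply: negligible_bigcup_count => r Zr; apply/negligibleP.
suff E0 : m.-negligible (E `\` N).
  apply: negligibleS (negligibleU E0 N0) => x Ex.
  by have [Nx|Nx] := pselect (N x); [right|left].
have mEN : measurable (E `\` N) by exact: measurableD.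
apply/negligibleP => //.
have [M LM _] := @lebesgue_rV_sigma_finite R d.
move: m_ac; rewrite LM => /null_content_dominatesP; apply => //.
suff : lebesgue_rV d (E `\` N) = 0 by rewrite LM.
apply: (lebesgue_rV_line0 _ c.1.1) => //.
have key x y : (E `\` N) x -> (E `\` N) y ->
    (forall i, i != c.1.1 -> x ord0 i = y ord0 i) ->
    ~ (x ord0 c.1.1 < y ord0 c.1.1).
  move=> [Ex Nx] [Ey Ny] xy xyk.
  set h := y ord0 c.1.1 - x ord0 c.1.1.
  have h0 : 0 < h by rewrite subr_gt0.
  pose del : R := c.2.+1%:R^-1.
  have del0 : 0 < del by rewrite invr_gt0.
  have del1 : del <= 1 by rewrite invf_le1// ler1n.
  (* With 2 rho K = h del, the off-line error 4 d rho N equals rho K - 4 rho, which lies below (h -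
     2 rho) del = 2 rho K - 2 rho del; K >= 4 also gives 2 rho < h. *)
  pose K : R := 4 * (d%:R * c.2%:R + 1).
  have K0 : 4 <= K by rewrite /K ler_peMr// lerDr mulr_ge0.
  have K00 : 0 < K by rewrite (lt_le_trans _ K0).
  pose rho := h * del / (2 * K).
  have rho0 : 0 < rho by rewrite divr_gt0// mulr_gt0.
  have rhoK : 2 * (rho * K) = h * del by rewrite /rho; field; rewrite lt0r_neq0.
  have rho4 : rho * 4 <= rho * K by rewrite ler_pM2l.
  have hdel : h * del <= h by rewrite ler_piMr// ltW.
  have [r ry rP] := ratball_small _ y _ rho0.
  have [r' rx rP'] := ratball_small _ x _ rho0.
  have gt0 s w : E w -> ~ N w -> ratball d s w -> (0 < m (ratball d s `&` E))%E.
    move=> Ew Nw sw; rewrite lt_def measure_ge0 andbT; apply/eqP => s0.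
    by apply: Nw; exists s.
  have := ot_maps_monotone_ae _ _ _ _ o1 o2 => -[W [mW W0 WP]].
  have sub : (ratball d r `&` E) `*` (ratball d r' `&` E) `<=` W.
    move=> [z z'] [[/= zr zE] [z'r z'E]]; apply: WP => /=; apply/negP.
    rewrite -ltNge; apply: (gap_set_dotv v1 v2 c x y z z' rho) => //.
    - by rewrite -/h; lra.
    - rewrite -/h -/del.
      have -> : 4 * d%:R * rho * c.2%:R = rho * K - 4 * rho by rewrite /K; ring.
      have : 2 * rho * del <= 2 * rho by rewrite ler_piMr// mulr_ge0// ltW.
      rewrite mulrBl -rhoK; lra.
    - exact: rP.
    - exact: rP'.
  have : (prob_square m ((ratball d r `&` E) `*` (ratball d r' `&` E)) <= 0)%E.
    rewrite -W0; apply: le_measure => //; rewrite inE//.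
    by apply: measurableX.
  rewrite prob_square_rect// leNgt => /negP; apply.
  by rewrite mule_gt0// (gt0 _ _ _ _ ry, gt0 _ _ _ _ rx).
move=> x y Ex Ey xy; apply/rowP => i.
have [->|ik] := eqVneq i c.1.1; last exact: xy.
apply/eqP; rewrite eq_le !leNgt; apply/andP; split; apply/negP.
  by apply: key => // j jk; rewrite xy.
exact: key.
Qed.

Lemma ot_map_unique m n (v1 v2 : V -> V) : m `<< lebesgue_rV d ->
  is_ot_map m n v1 -> is_ot_map m n v2 -> {ae m, forall x, v1 x = v2 x}.
Proof.
move=> mac o1 o2.
have : m.-negligible [set x | v1 x != v2 x].
  apply: (negligibleS (@neq_sub_gap_set v1 v2)).
  apply: negligibleU; apply: negligible_bigcup_count => c _.
    exact: (gap_set_null m n).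
  exact: (gap_set_null m n).
by apply: negligibleS => x /= /eqP.
Qed.

End Uniqueness.

(** * Subgradient inequalities *)

Lemma pushforward_ae_eq d1 d2 (T1 : measurableType d1) (T2 : measurableType d2)
  (R : realType) (m : {measure set T1 -> \bar R}) (f g : T1 -> T2) :
  measurable_fun setT f -> measurable_fun setT g ->
  {ae m, forall x, f x = g x} -> eq_meas (pushforward m f) (pushforward m g).
Proof.
move=> mf mg fg A mA.
have indE (h : T1 -> T2) : measurable_fun setT h ->
    pushforward m h A = (\int[m]_x (\1_A (h x))%:E)%E.
  move=> mh; rewrite (_ : (fun x => _) = (fun x => (\1_(h @^-1` A) x)%:E))//.
  by rewrite integral_indic// ?setIT// -[X in measurable X]setTI; exact: mh.
have mind (h : T1 -> T2) : measurable_fun setT h ->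
    measurable_fun setT (fun x => (\1_A (h x))%:E : \bar R).
  by move=> mh; apply: measurableT_comp => //; apply: (measurableT_comp _ mh).
rewrite !indE//; apply: ge0_ae_eq_integral => //; try exact: mind.
by apply: filterS fg => x -> _.
Qed.

(** A crude bound that suffices for integrability of inner products of square-integrable fields. *)
Lemma normr_dotv_le (R : realType) (d : nat) (x y : 'rV[R]_d) :
  `|dotv x y| <= sqnorm x + sqnorm y.
Proof.
rewrite /sqnorm /dotv -big_split/= (le_trans (ler_norm_sum _ _ _))//.
apply: ler_sum => i _; rewrite ler_norml.
have := sqr_ge0 (x ord0 i + y ord0 i); have := sqr_ge0 (x ord0 i - y ord0 i).
have := sqr_ge0 (x ord0 i); have := sqr_ge0 (y ord0 i).
by move=> *; apply/andP; split; nra.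
Qed.

Lemma integrable_sqnorm (R : realType) (d : nat) dT (T : measurableType dT)
  (m : {measure set T -> \bar R}) (f : T -> 'rV[R]_d) :
  measurable_fun setT f -> (\int[m]_x (sqnorm (f x))%:E < +oo)%E ->
  m.-integrable setT (fun x => (sqnorm (f x))%:E).
Proof.
move=> mf If; apply/integrableP; split.
  by apply: measurableT_comp => //; exact: measurable_sqnorm.
rewrite (eq_integral (fun x => (sqnorm (f x))%:E))// => x _.
by rewrite gee0_abs// lee_fin sqnorm_ge0.
Qed.

Lemma integrable_dotv (R : realType) (d : nat) dT (T : measurableType dT)
  (m : {measure set T -> \bar R}) (f g : T -> 'rV[R]_d) :
  measurable_fun setT f -> (\int[m]_x (sqnorm (f x))%:E < +oo)%E ->
  measurable_fun setT g -> (\int[m]_x (sqnorm (g x))%:E < +oo)%E ->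
  m.-integrable setT (fun x => (dotv (f x) (g x))%:E).
Proof.
move=> mf If mg Ig.
apply: (le_integrable measurableT _ _ (integrableD measurableT
  (integrable_sqnorm _ _ _ _ m f mf If) (integrable_sqnorm _ _ _ _ m g mg Ig))).
  by apply: measurableT_comp => //; exact: measurable_dotv.
move=> x _ /=; rewrite lee_fin (le_trans (normr_dotv_le _ _ _ _))//.
exact: ler_norm.
Qed.

Section Steps.
Context {R : realType} {d : nat}.
Local Notation V := 'rV[R]_d.
Variable F : P2 R d -> \bar R.
Hypothesis F_ninfty : forall m, F m != -oo%E.
Hypothesis F_lsc : W2_lsc F.
Hypothesis F_conv : geodesically_convex F.
Hypothesis F_ac : forall m, (F m < +oo)%E -> m `<< lebesgue_rV d.
Hypothesis F_ot : forall m1 m2, (F m1 < +oo)%E -> (F m2 < +oo)%E ->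
  exists t, is_ot_map m1 m2 t.
Implicit Types mu nu : P2 R d.

Lemma F_fin mu : (F mu < +oo)%E -> F mu = (fine (F mu))%:E.
Proof. by move=> Foo; rewrite fineK// fin_numE F_ninfty lt_eqF. Qed.

Lemma W2_sym_dom mu nu : (F mu < +oo)%E -> (F nu < +oo)%E -> W2 mu nu = W2 nu mu.
Proof.
move=> Fm Fn; have [t ot] := F_ot _ _ Fm Fn; have [u ou] := F_ot _ _ Fn Fm.
by apply/eqP; rewrite eq_le (W2_sym_ot _ _ _ ot) (W2_sym_ot _ _ _ ou).
Qed.

Lemma W2_triangle_dom mu nu rho : (F mu < +oo)%E -> (F nu < +oo)%E ->
  (F rho < +oo)%E -> W2 mu rho <= W2 mu nu + W2 nu rho.
Proof.
move=> Fm Fn Fr; have [t ot] := F_ot _ _ Fm Fn; have [u ou] := F_ot _ _ Fn Fr.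
exact: (W2_triangle_ot _ _ _ _ _ ot ou).
Qed.

(** Take for [l] the time-s point of the geodesic of convexity. The optimal maps from [mu] to [l]
    and from [l] to [nu] compose to an optimal [v], of which [t] travels the fraction s by
    [ot_through_geodesic]. *)
Lemma geodesic_maps mu nu (s : R) : 0 < s < 1 ->
  (F mu < +oo)%E -> (F nu < +oo)%E ->
  exists l t v, [/\ F l = (fine (F l))%:E,
    fine (F l) <= (1 - s) * fine (F mu) + s * fine (F nu),
    W2 mu l = s * W2 mu nu, is_ot_map mu l t &
    is_ot_map mu nu v /\ {ae mu, forall x, t x - x = s *: (v x - x)}].
Proof.
move=> s01 Fm Fn; have [s0 s1] := andP s01.
have [lam [l0 l1 lW] lF] := F_conv mu nu.
have s01' : 0 <= s <= 1 by rewrite !ltW.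
have := lF s s01'; rewrite (F_fin _ Fm) (F_fin _ Fn) -!EFinM -EFinD => Fl.
have Floo : (F (lam s) < +oo)%E by rewrite (le_lt_trans Fl)// ltry.
have W1 : W2 mu (lam s) = s * W2 mu nu.
  rewrite -(eq_W2 _ _ _ _ l0 (fun _ _ => erefl)) lW// ?lexx ?ler01//.
  by rewrite sub0r normrN gtr0_norm.
have W1' : W2 (lam s) nu = (1 - s) * W2 mu nu.
  rewrite -(eq_W2 _ _ _ _ (fun _ _ => erefl) l1) lW// ?lexx ?ler01//.
  by rewrite distrC gtr0_norm// subr_gt0.
have [t ot] := F_ot _ _ Fm Floo; have [u ou] := F_ot _ _ Floo Fn.
have [ov vt] := ot_through_geodesic s _ _ _ t u s01 W1 W1' ot ou.
exists (lam s), t, (u \o t); split=> //; first exact: F_fin.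
by move: Fl; rewrite (F_fin _ Floo) lee_fin.
Qed.

(* Optimal maps out of an absolutely continuous measure are unique, so the
   displacement interpolation is the geodesic along which F is convex. *)
Lemma F_interpolation mu nu rho tau (s : R) : 0 < s < 1 ->
  (F mu < +oo)%E -> (F nu < +oo)%E -> is_ot_map mu nu tau ->
  is_pushforward (fun x => (1 - s) *: x + s *: tau x) mu rho ->
  (F rho < +oo)%E /\ fine (F rho) <= (1 - s) * fine (F mu) + s * fine (F nu).
Proof.
move=> s01 Fm Fn otau [mr rhoE].
have [l [t [v [Fl Fle _ [[mt lE] _] [ov vt]]]]] := geodesic_maps _ _ s s01 Fm Fn.
have tauv := ot_map_unique _ _ _ _ (F_ac _ Fm) otau ov.
suff <- : F l = F rho by split=> //; rewrite Fl ltry.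
apply: eq_meas_F => // A mA; rewrite lE// rhoE// /pushforward.
apply: pushforward_ae_eq => //.
apply: filterS2 vt tauv => x tx tauvx; apply/rowP => i.
by have /rowP/(_ i) := tx; rewrite -tauvx !mxE; lra.
Qed.

Lemma L2sqnorm_ge0 mu (xi : V -> V) : 0 <= L2sqnorm mu xi.
Proof. by apply: fine_ge0; apply: integral_ge0 => x _; rewrite lee_fin sqnorm_ge0. Qed.

Lemma L2sqnormE mu (xi : V -> V) : in_L2 mu xi ->
  (\int[mu]_x (sqnorm (xi x))%:E = (L2sqnorm mu xi)%:E)%E.
Proof.
move=> [_ xioo]; rewrite /L2sqnorm fineK// ge0_fin_numE//.
by apply: integral_ge0 => x _; rewrite lee_fin sqnorm_ge0.
Qed.

(** The local inequality is applied at a geodesic point closer than [delta], where the displacement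
    is s (v - id); convexity then allows division by s. The [v] obtained depends on [e], so the
    error is kept until [v] has disappeared. *)
Lemma subdiff_ineq mu nu (xi : V -> V) (e : R) : 0 < e -> (F nu < +oo)%E ->
  subdiff F mu xi -> exists2 v, is_ot_map mu nu v &
  (\int[mu]_x (dotv (xi x) (v x - x))%:E <=
    (fine (F nu) - fine (F mu) + e * W2 mu nu)%:E)%E.
Proof.
move=> e0 Fn [Fm [mxi xioo] sub]; have [delta delta0 {}sub] := sub e e0.
pose W := W2 mu nu; have W0 : 0 <= W := W2_ge0 _ _.
have W10 : 0 < W + 1 by rewrite ltr_wpDl.
(* The bound 1/2 keeps s below 1, and W + 1 avoids a zero denominator. *)
pose s := Num.min 2^-1 (delta / (W + 1)).
have s01 : 0 < s < 1.
  rewrite lt_min invr_gt0 ltr0n/= divr_gt0//= gt_min.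
  by apply/orP; left; rewrite invf_lt1// ltr1n.
have [s0 s1] := andP s01.
have sW : s * W < delta.
  rewrite (@le_lt_trans _ _ (delta / (W + 1) * W))//.
    by rewrite ler_wpM2r// ge_min lexx orbT.
  by rewrite -mulrA gtr_pMr// ltr_pdivrMl// mulr1 ltrDl.
have [l [t [v [Fl Fle Wl ot [ov vt]]]]] := geodesic_maps _ _ s s01 Fm Fn.
exists v => //.
have Floo : (F l < +oo)%E by rewrite Fl ltry.
have [[mt _] _] := ot; have [[mv _] Iv] := ov.
have mvid : measurable_fun setT (fun x : V => v x - x) by exact: measurable_subv.
have mtid : measurable_fun setT (fun x : V => t x - x) by exact: measurable_subv.
have Iv' : (\int[mu]_x (sqnorm (v x - x))%:E < +oo)%E.
  by under eq_integral do rewrite sqnormB; rewrite Iv ltry.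
have idot := integrable_dotv _ _ _ _ mu xi (fun x => v x - x) mxi xioo mvid Iv'.
have := sub l t Floo ot; rewrite Wl => /(_ sW).
have -> : (\int[mu]_x (dotv (xi x) (t x - x))%:E =
    s%:E * \int[mu]_x (dotv (xi x) (v x - x))%:E)%E.
  rewrite -integralZl//; apply: ae_eq_integral => //.
  - by apply: measurableT_comp => //; exact: measurable_dotv.
  - by apply: measurable_funeM; apply: measurableT_comp => //; exact: measurable_dotv.
  - apply: filterS vt => x -> _; rewrite -EFinM; congr (_%:E).
    by rewrite /dotv mulr_sumr; apply: eq_bigr => i _; rewrite !mxE; ring.
have Ifin := integrable_fin_num measurableT idot.
rewrite -(fineK Ifin) Fl (F_fin _ Fm) -EFinM -!EFinB !lee_fin -/W => H.
rewrite -(ler_pM2l s0); nra.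
Qed.

(** The pair (x - eta xi(x), v(x)) couples [mu'] with [nu]. Expanding its cost leaves a cross term
    that [subdiff_ineq] controls. *)
Lemma euler_step mu mu' nu (xi : V -> V) (eta : R) : 0 < eta ->
  (F nu < +oo)%E -> subdiff F mu xi ->
  is_pushforward (fun x => x - eta *: xi x) mu mu' ->
  2 * eta * (fine (F mu) - fine (F nu)) <=
    W2 mu nu ^+ 2 - W2 mu' nu ^+ 2 + eta ^+ 2 * L2sqnorm mu xi.
Proof.
move=> eta0 Fn sub [mX muX]; have [Fm [mxi xioo] _] := sub.
apply/ler_addgt0Pr => e e0; have W0 := W2_ge0 mu nu.
have W10 : 0 < W2 mu nu + 1 by rewrite ltr_wpDl.
(* Chosen so that the error 2 eta e' W2 stays below [e]. *)
pose e' := e / (2 * eta * (W2 mu nu + 1)).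
have e'0 : 0 < e' by rewrite divr_gt0// !mulr_gt0.
have [v [[mv muv] Iv] Ile] := subdiff_ineq mu nu xi e' e'0 Fn sub.
have mvid : measurable_fun setT (fun x : V => v x - x) by exact: measurable_subv.
have midv : measurable_fun setT (fun x : V => x - v x) by exact: measurable_subv.
have Iv' : (\int[mu]_x (sqnorm (v x - x))%:E < +oo)%E.
  by under eq_integral do rewrite sqnormB; rewrite Iv ltry.
have Iv'' : (\int[mu]_x (sqnorm (x - v x))%:E < +oo)%E by rewrite Iv ltry.
have idot := integrable_dotv _ _ _ _ mu xi (fun x => v x - x) mxi xioo mvid Iv'.
have isv := integrable_sqnorm _ _ _ _ mu (fun x => x - v x) midv Iv''.
have isxi := integrable_sqnorm _ _ _ _ mu xi mxi xioo.
have := sqrW2_le _ _ mu (fun x => x - eta *: xi x) v mu' nu mX mv muX muv.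
have -> : (\int[mu]_x (sqnorm (x - eta *: xi x - v x))%:E =
   (W2 mu nu ^+ 2)%:E + ((eta ^+ 2)%:E * (L2sqnorm mu xi)%:E +
   (2 * eta)%:E * \int[mu]_x (dotv (xi x) (v x - x))%:E))%E.
  rewrite -Iv -L2sqnormE// -!integralZl// -integralD//; try exact: integrableZl.
  rewrite -integralD//; last by apply: integrableD => //; exact: integrableZl.
  apply: eq_integral => x _; rewrite -!EFinM -!EFinD; congr (_%:E).
  rewrite /sqnorm /dotv !mulr_sumr -!big_split/=.
  by apply: eq_bigr => i _; rewrite !mxE; ring.
have Ifin := integrable_fin_num measurableT idot.
move: Ile; rewrite -(fineK Ifin) -!EFinM -!EFinD !lee_fin => Ile H.
have : e' * (2 * eta * (W2 mu nu + 1)) = e.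
  by rewrite /e' divfK// lt0r_neq0// !mulr_gt0.
have : 0 < e' * eta by rewrite mulr_gt0.
have := ler_wpM2l (ltW eta0) Ile.
nra.
Qed.

Lemma W2_euler_step mu mu' (xi : V -> V) (eta : R) : 0 <= eta ->
  in_L2 mu xi -> is_pushforward (fun x => x - eta *: xi x) mu mu' ->
  W2 mu mu' <= eta * Num.sqrt (L2sqnorm mu xi).
Proof.
move=> eta0 L2xi [mX muX]; have [mxi _] := L2xi.
rewrite -(@ler_pXn2r _ 2)// ?nnegrE ?W2_ge0 ?mulr_ge0//.
rewrite exprMn (sqr_sqrtr (L2sqnorm_ge0 mu xi)) -lee_fin (EFinM (eta ^+ 2)) -L2sqnormE//.
have := sqrW2_le _ _ mu id (fun x => x - eta *: xi x) mu mu'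
  (@measurable_id _ _ _) mX (fun _ _ => erefl) muX.
move=> /le_trans; apply; rewrite -ge0_integralZl_EFin//; last 3 first.
- by move=> x _; rewrite lee_fin sqnorm_ge0.
- by apply: measurableT_comp => //; exact: measurable_sqnorm.
- exact: sqr_ge0.
rewrite le_eqVlt; apply/orP; left; apply/eqP; apply: eq_integral => x _.
rewrite -EFinM; congr (_%:E); rewrite /sqnorm /dotv mulr_sumr.
by apply: eq_bigr => i _; rewrite !mxE; ring.
Qed.

End Steps.

(** * Regret of the adaptive step sizes *)

Section AdaptiveStepRegret.
Context {R : realType}.
(** Purely numerical setting: [r] stands for the running radius, [g] for squared gradient norms, [f]
    for the gaps to the minimum, [d] for distances to the minimizer, and r / q for the step size. *)
Variables (T : nat) (D r0 : R) (r g f d : nat -> R).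
Let G t := \sum_(s < t.+1) g s.
Let q t := Num.sqrt (G t).
Hypothesis r0_gt0 : 0 < r0.
Hypothesis r_ge : forall t, r0 <= r t.
Hypothesis r_nd : forall t, r t <= r t.+1.
Hypothesis r_double : forall t, r t.+1 <= 2 * r t.
Hypothesis r_le : r T <= D.
Hypothesis d_ge0 : forall t, 0 <= d t.
Hypothesis d_le : forall t, (t <= T)%N -> d t <= 2 * D.
Hypothesis d_lip : forall s t, (s <= t)%N -> d s <= d t + 2 * r t.
Hypothesis g_ge0 : forall t, 0 <= g t.
Hypothesis G_gt0 : forall t, 0 < G t.
Hypothesis f_ge0 : forall t, 0 <= f t.
Hypothesis step : forall t, 2 * (r t / q t) * f t <=
  d t ^+ 2 - d t.+1 ^+ 2 + (r t / q t) ^+ 2 * g t.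

Let r_gt0 t : 0 < r t. Proof. exact: lt_le_trans (r_ge t). Qed.
Let r_mono s t : (s <= t)%N -> r s <= r t.
Proof. exact: (homo_leq (@lexx _ _) (@le_trans _ _)). Qed.
Let D_gt0 : 0 < D. Proof. exact: lt_le_trans (r_le). Qed.
Let q_gt0 t : 0 < q t. Proof. by rewrite sqrtr_gt0. Qed.
Let qq t : q t ^+ 2 = G t. Proof. by rewrite sqr_sqrtr// ltW. Qed.
Let GS t : G t.+1 = G t + g t.+1. Proof. by rewrite /G big_ord_recr. Qed.
Let q_nd t : q t <= q t.+1.
Proof. by apply: ler_wsqrtr; rewrite GS lerDl. Qed.

(** Since g_(t+1) = q_(t+1)^2 - q_t^2, the new term is at most 2 (q_(t+1) - q_t), which
    telescopes. *)
Lemma sum_div_sqrt_le t : \sum_(s < t.+1) g s / q s <= 2 * q t.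
Proof.
elim: t => [|t IH].
  rewrite big_ord1 ler_pdivrMr// -mulrA -expr2 qq /G big_ord1 ler_peMl//.
  by rewrite ler1n.
rewrite big_ord_recr/=; apply: le_trans (lerD IH (lexx _)) _.
rewrite -lerBrDl ler_pdivrMr//.
have -> : g t.+1 = q t.+1 ^+ 2 - q t ^+ 2 by rewrite !qq GS addrC addKr.
have := q_nd t; have := q_gt0 t.
by move: (q t) (q t.+1) => a b a0 ab; nra.
Qed.

(** Abel summation with nondecreasing weights: raising q_t to q_(t+1) is paid for by K - d_(t+1)^2
    >= 0. *)
Lemma sum_sqr_diff_le t (K : R) : (forall s, (s <= t)%N -> d s ^+ 2 <= K) ->
  \sum_(s < t.+1) q s * (d s ^+ 2 - d s.+1 ^+ 2) <= q t * (K - d t.+1 ^+ 2).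
Proof.
elim: t => [|t IH] dK.
  by rewrite big_ord1; apply: ler_wpM2l; [exact: ltW|rewrite lerD2r dK].
rewrite big_ord_recr/=.
apply: le_trans (lerD (IH _) (lexx _)) _; first by move=> s st; rewrite dK// leqW.
have := q_nd t; have := dK t.+1 (leqnn _).
move: (q t) (q t.+1) (d t.+1 ^+ 2) (d t.+2 ^+ 2) => a b x y xK ab.
nra.
Qed.

(* 17 = (32 + 2) / 2, from h3 and h5. *)
Lemma weighted_regret_le t : (t < T)%N ->
  \sum_(s < t.+1) r s * f s <= 17 * D * q t * r t.
Proof.
move=> tT.
have rD : r t <= D by rewrite (le_trans _ r_le)// r_mono// ltnW.
(* From [d_lip] and doubling, d_s <= d_(t+1) + 2 r_(t+1) <= d_(t+1) + 4 r_t. *)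
pose K := (d t.+1 + 4 * r t) ^+ 2.
have dK s : (s <= t)%N -> d s ^+ 2 <= K.
  move=> st; rewrite ler_pXn2r ?nnegrE ?addr_ge0 ?mulr_ge0 ?(ltW (r_gt0 _))//.
  rewrite (le_trans (d_lip _ _ (leqW st)))// lerD2l.
  by have := r_double t; lra.
(* Multiplying the descent inequality by q_s clears the step size and leaves 2 r_s f_s on the
   left. *)
have step' s : (s <= t)%N -> r s * f s <=
    2^-1 * (q s * (d s ^+ 2 - d s.+1 ^+ 2) + r t ^+ 2 * (g s / q s)).
  move=> st; have := step s; rewrite -(ler_pM2l (q_gt0 s)).
  have -> : q s * (2 * (r s / q s) * f s) = 2 * (r s * f s).
    by field; rewrite lt0r_neq0.
  rewrite mulrDr.
  have -> : q s * ((r s / q s) ^+ 2 * g s) = r s ^+ 2 * (g s / q s).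
    by field; rewrite lt0r_neq0.
  have : r s ^+ 2 * (g s / q s) <= r t ^+ 2 * (g s / q s).
    rewrite ler_wpM2r ?divr_ge0 ?(ltW (q_gt0 _))//.
    by rewrite ler_pXn2r ?nnegrE ?(ltW (r_gt0 _))// r_mono.
  by lra.
apply: (@le_trans _ _ (\sum_(s < t.+1)
   2^-1 * (q s * (d s ^+ 2 - d s.+1 ^+ 2) + r t ^+ 2 * (g s / q s)))).
  by apply: ler_sum => s _; apply: step'; rewrite -ltnS.
rewrite -mulr_sumr big_split/= -mulr_sumr.
have h1 := sum_sqr_diff_le t K dK.
have h2 := ler_wpM2l (sqr_ge0 (r t)) (sum_div_sqrt_le t).
(* The difference is 8 d_(t+1) r_t + 16 r_t^2, with d_(t+1) <= 2 D and r_t <= D; the former is where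
   t < T enters. *)
have h3 : K - d t.+1 ^+ 2 <= 32 * D * r t.
  have := d_le _ tT; have := d_ge0 t.+1; have := r_gt0 t; rewrite /K.
  by move: (d t.+1) (r t) rD => x y; nra.
have h4 := ler_wpM2l (ltW (q_gt0 t)) h3.
have h5 : r t ^+ 2 * (2 * q t) <= 2 * D * q t * r t.
  rewrite expr2 -mulrA [leRHS]mulrC ler_pM2l// mulrC -mulrA [D * _]mulrC mulrA.
  by rewrite ler_pM2l// mulr_gt0.
lra.
Qed.

(* Abel summation trades the weights [r] for the logarithmic factor. *)
Lemma regret_le t : (t < T)%N ->
  \sum_(s < t.+1) f s <=
  (\sum_(s < t.+1) r s * f s) / r t + 17 * D * q t * ln (r t / r 0%N).
Proof.
elim: t => [|t IH] tT.
  by rewrite !big_ord1 divff ?lt0r_neq0// ln1 mulr0 addr0 mulrAC divff ?mul1r ?lt0r_neq0.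
rewrite big_ord_recr [in leRHS]big_ord_recr/=.
have tT' : (t < T)%N by exact: ltnW.
apply: le_trans (lerD (IH tT') (lexx _)) _.
set S := \sum_(s < t.+1) r s * f s.
have -> : (S + r t.+1 * f t.+1) / r t.+1 = S / r t.+1 + f t.+1.
  by field; rewrite lt0r_neq0.
have S_le : S <= 17 * D * q t * r t by exact: weighted_regret_le.
pose x := r t / r t.+1.
have x0 : 0 < x by rewrite divr_gt0.
have x1 : x <= 1 by rewrite ler_pdivrMr// mul1r.
have lnx : 1 - x <= - ln x.
  have := @le_ln1Dx R (x - 1); rewrite (_ : 1 + (x - 1) = x); last by ring.
  by rewrite ltrBDl subrr x0 => /(_ isT); lra.
have lnS : ln (r t.+1 / r 0%N) = ln (r t / r 0%N) - ln x.
  rewrite -ln_div ?posrE ?divr_gt0//; congr ln.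
  by rewrite /x; field; rewrite !lt0r_neq0.
have c0 : 0 <= 17 * D by rewrite mulr_ge0// ltW.
have ln0 : 0 <= ln (r t / r 0%N).
  by rewrite ln_ge0// ler_pdivlMr// mul1r r_mono.
have lnx0 : 0 <= - ln x by rewrite oppr_ge0 ln_le0.
(* Passing from r_t to r_(t+1) in the denominator loses (S / r_t)(1 - x), and 1 - x <= - ln x turns
   this into an increment of the logarithm. *)
have h1 : S / r t <= S / r t.+1 + 17 * D * q t * (- ln x).
  have -> : S / r t.+1 = S / r t * x.
    by rewrite /x; field; rewrite !lt0r_neq0.
  have : S / r t <= 17 * D * q t by rewrite ler_pdivrMr.
  have : 0 <= S / r t.
    apply: divr_ge0; last exact/ltW.
    by apply: sumr_ge0 => s _; apply: mulr_ge0 => //; exact/ltW.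
  have : 0 <= 17 * D * q t by exact: mulr_ge0 c0 (ltW (q_gt0 t)).
  move: (S / r t) (17 * D * q t) => a b b0 a0 ab.
  have : a * (1 - x) <= b * (- ln x) by rewrite ler_pM// subr_ge0.
  by rewrite mulrBr mulr1; lra.
rewrite lnS.
(* Monotonicity of q gathers all logarithmic increments under the latest q. *)
have h2 : 17 * D * q t * (ln (r t / r 0%N) - ln x) <=
          17 * D * q t.+1 * (ln (r t / r 0%N) - ln x).
  by rewrite ler_wpM2r ?addr_ge0// ler_wpM2l.
move: h1 h2; rewrite mulrBr mulrN; lra.
Qed.

(** The weighted sum divided by the last radius gives the summand 1; the logarithm is bounded
    because r stays between r0 and D up to time T. *)
Lemma adaptive_regret_le : (0 < T)%N ->
  \sum_(s < T) f s <= 17 * D * q T.-1 * (1 + ln (D / r0)).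
Proof.
move=> T0; have TT : (T.-1 < T)%N by rewrite prednK.
have := regret_le _ TT; rewrite prednK// => /le_trans; apply.
rewrite mulrDr mulr1 lerD//.
  by rewrite ler_pdivrMr//; have := weighted_regret_le _ TT; rewrite prednK.
apply: ler_wpM2l; first by rewrite !mulr_ge0// ltW.
rewrite ler_ln ?posrE ?divr_gt0//; apply: ler_pM; rewrite ?invr_ge0.
- exact: ltW.
- exact: ltW.
- by rewrite (le_trans _ r_le)// r_mono// leq_pred.
- by rewrite lef_pV2 ?posrE.
Qed.

End AdaptiveStepRegret.

(** * Bounds on the running radius and the accumulated gradient norms *)

Section AdaptiveQuantities.
Context {R : realType} {d : nat}.
Variables (reps : R) (mu : nat -> P2 R d) (xi : nat -> 'rV[R]_d -> 'rV[R]_d).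

Lemma rbar_ge_reps t : reps <= rbar reps mu t.
Proof. exact: bigmax_ge_id. Qed.

Lemma W2_le_rbar s t : (s <= t)%N -> W2 (mu 0%N) (mu s) <= rbar reps mu t.
Proof.
rewrite -ltnS => st.
exact: (@le_bigmax _ _ _ reps (fun i : 'I_t.+1 => W2 (mu 0%N) (mu i)) (Ordinal st)).
Qed.

Lemma rbar_le t (x : R) : reps <= x ->
  (forall s, (s <= t)%N -> W2 (mu 0%N) (mu s) <= x) -> rbar reps mu t <= x.
Proof. by move=> rx h; apply: bigmax_le => // s _; apply: h; rewrite -ltnS. Qed.

Lemma L2norm_le_Gsup T t : (t <= T)%N -> L2norm (mu t) (xi t) <= Gsup mu xi T.
Proof.
move=> tT; apply: ub_le_sup; last by exists t.
(* The finite sum shows that the set is bounded above, so that [sup] is a genuine supremum. *)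
exists (\sum_(s < T.+1) L2norm (mu s) (xi s)) => _ [s /= sT <-].
rewrite -ltnS in sT; rewrite (bigD1 (Ordinal sT))//= lerDl.
by apply: sumr_ge0 => i _; exact: sqrtr_ge0.
Qed.

Lemma sqrt_Gsum_le T t : (t <= T)%N ->
  Num.sqrt (Gsum mu xi t) <= Num.sqrt t.+1%:R * Gsup mu xi T.
Proof.
move=> tT; have G0 : 0 <= Gsup mu xi T.
  by rewrite (le_trans _ (L2norm_le_Gsup T 0%N _))// sqrtr_ge0.
rewrite -(ger0_norm G0) -sqrtr_sqr -sqrtrM//; apply: ler_wsqrtr.
rewrite mulr_natl -[X in _ *+ X]card_ord -sumr_const; apply: ler_sum => s _.
rewrite -[leLHS]sqr_sqrtr ?L2sqnorm_ge0// ler_pXn2r ?nnegrE ?sqrtr_ge0//.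
by apply: L2norm_le_Gsup; rewrite (leq_trans _ tT)// -ltnS.
Qed.

End AdaptiveQuantities.

(** * Convergence of the averaged iterates *)

Theorem corollary49 (R : realType) :
  exists2 C : R, 0 < C &
  forall (d : nat) (F : P2 R d -> \bar R) (pi : P2 R d)
    (mu mubar : nat -> P2 R d) (xi tau : nat -> 'rV[R]_d -> 'rV[R]_d)
    (reps D : R) (T : nat),
  (forall m, F m != -oo%E) ->
  is_proper F ->
  W2_lsc F ->
  geodesically_convex F ->
  (* the domain of F consists of absolutely continuous measures, and optimal
     transport maps between its elements exist *)
  (forall m, (F m < +oo)%E -> m `<< lebesgue_rV d) ->
  (forall m1 m2, (F m1 < +oo)%E -> (F m2 < +oo)%E ->
    exists t, is_ot_map m1 m2 t) ->
  (* minimizer *)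
  (forall m, (F pi <= F m)%E) ->
  (* forward Euler iterates with adaptive steps *)
  0 < reps ->
  (forall t, is_wgrad F (mu t) (xi t)) ->
  (forall t, 0 < Gsum mu xi t) ->
  (forall t, is_pushforward (fun x => x - stepsize reps mu xi t *: xi t x)
    (mu t) (mu t.+1)) ->
  (* uniform averages *)
  eq_meas (mubar 1%N) (mu 0%N) ->
  (forall t, (1 <= t)%N -> is_ot_map (mubar t) (mu t) (tau t)) ->
  (forall t, (1 <= t)%N ->
    is_pushforward
      (fun x => (1 - t.+1%:R^-1) *: x + t.+1%:R^-1 *: tau t x)
      (mubar t) (mubar t.+1)) ->
  (1 <= T)%N ->
  W2 (mu 0%N) pi <= D ->
  rbar reps mu T <= D ->
  (F (mubar T) - F pi <=
    (C * (D * Gsup mu xi T / Num.sqrt T%:R) * log_plus (D / reps))%:E)%E.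
Proof.
exists 17 => // d F pi mu mubar xi tau reps D T F_ninfty [mu_fin F_mu_fin] F_lsc
  F_conv F_ac F_ot F_min reps0 wgrad G0 muS mubar1 tauP mubarS T1 WD rD.
have Fpi : (F pi < +oo)%E by exact: le_lt_trans (F_min _) F_mu_fin.
have sub t : subdiff F (mu t) (xi t) by have [] := wgrad t.
have Fmu t : (F (mu t) < +oo)%E by have [] := sub t.
have L2xi t : in_L2 (mu t) (xi t) by have [] := sub t.
pose Fm t := fine (F (mu t)).
(* [mubar t] averages the t iterates with indices 0 to t - 1. Finiteness of F is part of the
   induction because [F_interpolation] requires it at each step. *)
have avg t : (1 <= t)%N -> (F (mubar t) < +oo)%E /\
    t%:R * fine (F (mubar t)) <= \sum_(s < t) Fm s.
  elim: t => [//|[_ _|t IH _]].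
    have -> : F (mubar 1%N) = F (mu 0%N) by exact: eq_meas_F.
    by rewrite Fmu big_ord1 mul1r.
  have [Ft It] := IH isT.
  have s01 : 0 < (t.+2%:R^-1 : R) < 1.
    by rewrite invr_gt0 ltr0n/= invf_lt1 ?ltr0n// ltr1n.
  have [Ft' le_t] := F_interpolation F F_ninfty F_lsc F_conv F_ac F_ot _ _ _ _ _
    s01 Ft (Fmu t.+1) (tauP t.+1 isT) (mubarS t.+1 isT).
  split=> //; rewrite big_ord_recr/=; apply: le_trans (lerD It (lexx _)).
  have t2 : 0 <= t.+2%:R :> R by rewrite ler0n.
  apply: le_trans (ler_wpM2l t2 le_t) _.
  rewrite mulrDr !mulrA mulrBr mulr1 divff ?pnatr_eq0// mul1r.
  by rewrite -[in leLHS]natr1 addrK.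
have [FT IT] := avg T T1.
pose eta := stepsize reps mu xi; pose r := rbar reps mu.
have r0 t : 0 < r t by rewrite (lt_le_trans reps0)// rbar_ge_reps.
have eta0 t : 0 < eta t by rewrite divr_gt0// sqrtr_gt0.
(* The step length is at most rbar_t times |xi_t| / sqrt G_t, and |xi_t|^2 is one of the summands of
   G_t. *)
have W2S t : W2 (mu t) (mu t.+1) <= r t.
  apply: le_trans (W2_euler_step _ _ _ _ (ltW (eta0 t)) (L2xi t) (muS t)) _.
  rewrite /eta /stepsize mulrAC -mulrA ger_pMr// ler_pdivrMr ?sqrtr_gt0// mul1r.
  apply: ler_wsqrtr; rewrite /Gsum big_ord_recr/= lerDr.
  by apply: sumr_ge0 => i _; exact: L2sqnorm_ge0.
have tri := W2_triangle_dom F F_ot.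
have rS t : r t <= r t.+1.
  by apply: rbar_le => [|s st]; [exact: rbar_ge_reps|apply: W2_le_rbar; exact: leqW].
have r2 t : r t <= 2 * r t by rewrite ler_peMl ?ltW// ltr1n.
(* Only the new distance to [mu t.+1] matters; it is at most rbar_t plus one step. *)
have r_double t : r t.+1 <= 2 * r t.
  apply: rbar_le => [|s]; first exact: le_trans (rbar_ge_reps _ _ t) (r2 t).
  rewrite leq_eqVlt => /orP[/eqP ->|st]; last first.
    by rewrite ltnS in st; exact: le_trans (W2_le_rbar _ _ _ _ st) (r2 t).
  apply: le_trans (tri _ _ _ (Fmu 0%N) (Fmu t) (Fmu t.+1)) _.
  by rewrite mulr2n mulrDl mul1r lerD ?W2S// W2_le_rbar.
have r_mono s t : (s <= t)%N -> r s <= r t.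
  exact: (homo_leq (@lexx _ _) (@le_trans _ _)).
pose dist t := W2 (mu t) pi.
have W2C s t : W2 (mu s) (mu t) = W2 (mu t) (mu s).
  exact: (W2_sym_dom F F_ot).
have dist_lip s t : (s <= t)%N -> dist s <= dist t + 2 * r t.
  move=> st; apply: le_trans (tri _ _ _ (Fmu s) (Fmu t) Fpi) _.
  rewrite addrC lerD2l; apply: le_trans (tri _ _ _ (Fmu s) (Fmu 0%N) (Fmu t)) _.
  by rewrite (W2C s) mulr2n mulrDl mul1r lerD ?W2_le_rbar.
have dist_le t : (t <= T)%N -> dist t <= 2 * D.
  move=> tT; apply: le_trans (tri _ _ _ (Fmu t) (Fmu 0%N) Fpi) _.
  rewrite (W2C t) mulr2n mulrDl mul1r lerD// (le_trans _ rD)//.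
  exact: W2_le_rbar.
have f_ge0 t : 0 <= Fm t - fine (F pi).
  rewrite subr_ge0 -lee_fin -(F_fin F F_ninfty _ (Fmu t)).
  by rewrite -(F_fin F F_ninfty _ Fpi).
have regret := adaptive_regret_le T D reps r
  (fun t => L2sqnorm (mu t) (xi t)) (fun t => Fm t - fine (F pi)) dist
  reps0 (rbar_ge_reps reps mu) rS r_double rD (fun t => W2_ge0 (mu t) pi)
  dist_le dist_lip (fun t => L2sqnorm_ge0 (mu t) (xi t)) G0 f_ge0
  (fun t => euler_step F F_ninfty F_conv F_ot _ _ _ _ _ (eta0 t) Fpi (sub t) (muS t))
  T1.
rewrite (F_fin F F_ninfty _ FT) (F_fin F F_ninfty _ Fpi) -EFinB lee_fin.
have T0 : 0 < T%:R :> R by rewrite ltr0n.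
have D0 : 0 < D by rewrite (lt_le_trans (r0 T)).
have sqT : Num.sqrt T%:R ^+ 2 = T%:R :> R by rewrite sqr_sqrtr// ltW.
have sqT0 : 0 < Num.sqrt T%:R :> R by rewrite sqrtr_gt0.
(* Scaling by T compares with the sum of gaps, and T / sqrt T becomes the sqrt T of [sqrt_Gsum_le]
   for T summands. *)
rewrite -(ler_pM2l T0).
have -> : T%:R * (17 * (D * Gsup mu xi T / Num.sqrt T%:R) * log_plus (D / reps)) =
    17 * D * (Num.sqrt T%:R * Gsup mu xi T) * log_plus (D / reps).
  by rewrite -{1}sqT; field; rewrite lt0r_neq0.
apply: (@le_trans _ _ (\sum_(s < T) (Fm s - fine (F pi)))).
  by rewrite sumrB sumr_const card_ord -[fine (F pi) *+ T]mulr_natl mulrBr lerD2r.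
apply: le_trans regret _; apply: ler_wpM2r.
  (* The logarithm is nonnegative because D >= rbar_T >= reps. *)
  rewrite addr_ge0// ln_ge0// ler_pdivlMr// mul1r.
  exact: le_trans (rbar_ge_reps _ _ _) rD.
apply: ler_wpM2l; first by rewrite mulr_ge0// ltW.
have := sqrt_Gsum_le mu xi T T.-1 (leq_pred T).
by rewrite /Gsum prednK.
Qed.
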